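(* Let the operator $EM_v$ be normal, let $\mathcal{D}(EM_v)$ be dense in $L^2(\mu)$, and let $k\ge1$ be a fixed integer. Suppose $|E(f)|^2=E(|f|^2)$ on $S(v)$ for all $f\in\mathcal{D}((EM_v)^k)$. For $n\ge1$ put $A_n(|v|^2)=\sum_{0\le i\le n}(-1)^i\binom{n}{i}|v|^{2i}$. Then: (i) $EM_v$ is $k$-hyperexpansive if and only if $A_n(|v|^2)\le0$ for $n=1,2,\dots,k$; (ii) $EM_v$ is completely hyperexpansive if and only if the sequence $\{|v(t)|^{2n}\}_{n=0}^\infty$ is completely alternating for almost every $t\in\Omega$.
   Context: $(\Omega,\Sigma,\mu)$ is a $\sigma$-finite measure space and $\mathcal{A}\subseteq\Sigma$ is a $\sigma$-subalgebra such that $(\Omega,\mathcal{A},\mu)$ is also $\sigma$-finite. $L^2(\Sigma)=L^2(\mu)=L^2(\Omega,\Sigma,\mu)$ (complex-valued functions). Equalities and inequalities between functions hold $\mu$-a.e.; $S(v)=\{t\in\Omega: v(t)\ne0\}$. $E=E^{\mathcal{A}}$ is the conditional expectation with respect to $\mathcal{A}$: for $f\ge0$ $\Sigma$-measurable (then $E(f)$ may take values in $[0,\infty]$) or $f\in L^2(\Sigma)$, $E(f)$ is the unique $\mathcal{A}$-measurable function with $\int_A f\,d\mu=\int_A E(f)\,d\mu$ for all $A\in\mathcal{A}$ for which the integrals exist. For a general complex-valued $\Sigma$-measurable $f$, $E(f)$ is understood to be defined when $E(|f|)<\infty$ a.e. (by linearity from nonnegative functions). The function $v:\Omega\to\mathbb{C}$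 is $\Sigma$-measurable and conditionable, i.e. $E(v)$ is defined (in the paper $v=u(E(|w|^2))^{1/2}$ arises from a weighted conditional type operator $M_wEM_u$; taking $w=1$ gives arbitrary $v=u$). The operator $EM_v$ in $L^2(\mu)$ is $f\mapsto E(vf)$ with domain $\mathcal{D}(EM_v)=\{f\in L^2(\mu): E(vf)\in L^2(\mu)\}$ (which includes the requirement that $E(vf)$ is defined). A densely defined operator $T$ in a Hilbert space is normal if $T$ is closed and $T^*T=TT^*$. For $n\ge1$, put $\Theta_{T,n}(f)=\sum_{0\le i\le n}(-1)^i\binom{n}{i}\|T^i f\|^2$ for $f\in\mathcal{D}(T^n)$. $T$ is $k$-hyperexpansive ($k\ge1$) if $\Theta_{T,n}(f)\le0$ for all $f\in\mathcal{D}(T^n)$ and $n=1,\dots,k$; $T$ is completely hyperexpansive if $\Theta_{T,n}(f)\le0$ for all $f\in\mathcal{D}(T^n)$ and all $n\ge1$. A real sequence $\{\phi(n)\}_{n\ge0}$ is completely alternating if $\sum_{0\le i\le n}(-1)^i\binom{n}{i}\phi(m+i)\le0$ for all $m\ge0$ and $n\ge1$. *)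

(* Defs.v *)
From HB Require Import structures.
From mathcomp Require Import all_boot all_order all_algebra.
From mathcomp Require Import complex.
From mathcomp Require Import all_classical all_reals all_analysis.
From mathcomp Require Import measurable_realfun.

Set Implicit Arguments.
Unset Strict Implicit.
Unset Printing Implicit Defensive.

Import Order.TTheory GRing.Theory Num.Theory.
Import numFieldNormedType.Exports.

Local Open Scope classical_set_scope.
Local Open Scope ring_scope.
Local Open Scope complex_scope.

(* [modc z] is the modulus of [z] as an element of the real field [R]; the
   norm [`|z|] of the library lives in [R[i]]. *)
Definition modc (R : realType) (z : R[i]) : R := ComplexField.Normc.normc z.

Section L2.
Context (d : measure_display) (Omega : measurableType d) (R : realType).
Variable mu : {measure set Omega -> \bar R}.

(* Measurability for the Borel sigma-algebra of the complex plane. *)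
Definition cmeasurable (f : Omega -> R[i]) : Prop :=
  measurable_fun [set: Omega] (fun t => complex.Re (f t)) /\
  measurable_fun [set: Omega] (fun t => complex.Im (f t)).

Definition cintegral (f : Omega -> R[i]) : R[i] :=
  (\int[mu]_t complex.Re (f t))%R +i* (\int[mu]_t complex.Im (f t))%R.

(* Elements of the Hilbert space L^2(mu) are handled through representatives;
   equality in L^2(mu) is equality almost everywhere. *)
Definition L2 : set (Omega -> R[i]) :=
  [set f | cmeasurable f /\
           (\int[mu]_t ((modc (f t)) ^+ 2)%:E < +oo)%E].

Definition inner (f g : Omega -> R[i]) : R[i] :=
  cintegral (fun t => f t * conjc (g t)).

Definition l2norm (f : Omega -> R[i]) : R :=
  Num.sqrt (\int[mu]_t (modc (f t)) ^+ 2)%R.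

(* A partially defined operator of L^2(mu): the values of [oper] are only
   relevant on [dom]. *)
Record operator := Operator {
  dom : set (Omega -> R[i]);
  oper : (Omega -> R[i]) -> (Omega -> R[i]) }.

Implicit Type T : operator.

(* The graph is closed under almost everywhere equality in the second
   component, hence graphs describe operators on classes of functions. *)
Definition graph T : set ((Omega -> R[i]) * (Omega -> R[i])) :=
  [set p | dom T p.1 /\ L2 p.2 /\ {ae mu, forall t, p.2 t = oper T p.1 t}].

Definition densely_defined T : Prop :=
  dom T `<=` L2 /\
  forall f, L2 f -> forall e : R, 0 < e ->
    exists2 g, dom T g & l2norm (f \- g) < e.

Definition closed_operator T : Prop :=
  forall (f_ : nat -> Omega -> R[i]) (f g : Omega -> R[i]),
    (forall n, dom T (f_ n)) -> L2 f -> L2 g ->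
    (fun n => l2norm (f_ n \- f)) @ \oo --> (0 : R) ->
    (fun n => l2norm (oper T (f_ n) \- g)) @ \oo --> (0 : R) ->
    graph T (f, g).

(* Graph of T^*. *)
Definition adjoint_graph T : set ((Omega -> R[i]) * (Omega -> R[i])) :=
  [set p | L2 p.1 /\ L2 p.2 /\
           forall f, dom T f -> inner (oper T f) p.1 = inner f p.2].

(* Graph of the composition S1 S2 (S2 is applied first), with its maximal
   domain. *)
Definition comp_graph (S1 S2 : set ((Omega -> R[i]) * (Omega -> R[i]))) :
    set ((Omega -> R[i]) * (Omega -> R[i])) :=
  [set p | exists g, S2 (p.1, g) /\ S1 (g, p.2)].

Definition normal_operator T : Prop :=
  [/\ densely_defined T, closed_operator T &
      comp_graph (adjoint_graph T) (graph T) =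
      comp_graph (graph T) (adjoint_graph T)].

(* D(T^n), with T^0 the identity of L^2(mu). *)
Fixpoint dom_pow T (n : nat) : set (Omega -> R[i]) :=
  if n is m.+1 then [set f | dom T f /\ dom_pow T m (oper T f)] else L2.

Definition Theta T (n : nat) (f : Omega -> R[i]) : R :=
  \sum_(i < n.+1) (-1) ^+ i * 'C(n, i)%:R * l2norm (iter i (oper T) f) ^+ 2.

Definition hyperexpansive T (k : nat) : Prop :=
  forall n, (1 <= n <= k)%N -> forall f, dom_pow T n f -> Theta T n f <= 0.

Definition completely_hyperexpansive T : Prop :=
  forall n, (1 <= n)%N -> forall f, dom_pow T n f -> Theta T n f <= 0.

End L2.

Section CondExp.
Context (d : measure_display) (Omega : measurableType d) (R : realType).
Variable mu : {measure set Omega -> \bar R}.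
(* [A] is a sub-sigma-algebra; [g_sigma_algebraType A] is [Omega] equipped
   with the sigma-algebra generated by [A], that is, with [A] itself. *)
Variable A : set (set Omega).

Definition sub_sigma_algebra_of : Prop :=
  sigma_algebra [set: Omega] A /\ A `<=` d.-measurable.

Definition sigma_finite_on : Prop :=
  sigma_finite [set: g_sigma_algebraType A] mu.

Definition is_nncondexp (f g : Omega -> \bar R) : Prop :=
  [/\ measurable_fun [set: g_sigma_algebraType A]
       (g : g_sigma_algebraType A -> \bar R),
      (forall t, (0 <= g t)%E) &
      forall B, A B -> (\int[mu]_(t in B) f t = \int[mu]_(t in B) g t)%E].

(* E(f) for nonnegative [f], with values in [0, +oo]: a version of the
   conditional expectation. *)
Definition nncondexp (f : Omega -> \bar R) : Omega -> \bar R :=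
  xget (cst +oo%E) [set g | is_nncondexp f g].

(* E(f) is defined: E(|f|) is finite almost everywhere. *)
Definition conditionable (f : Omega -> R[i]) : Prop :=
  cmeasurable f /\
  {ae mu, forall t, (nncondexp (fun s => (modc (f s))%:E) t < +oo)%E}.

Definition rcondexp (f : Omega -> R) (t : Omega) : R :=
  fine (nncondexp (EFin \o f^\+) t) - fine (nncondexp (EFin \o f^\-) t).

(* E(f) for complex-valued [f], by linearity from nonnegative functions;
   meaningful when [f] is conditionable. *)
Definition condexp (f : Omega -> R[i]) (t : Omega) : R[i] :=
  rcondexp (fun s => complex.Re (f s)) t +i*
  rcondexp (fun s => complex.Im (f s)) t.

(* The operator E M_v: f |-> E(vf). *)
Definition cond_mul_op (v : Omega -> R[i]) : operator Omega R :=
  Operator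
    [set f | [/\ L2 mu f, conditionable (v \* f) & L2 mu (condexp (v \* f))]]
    (fun f => condexp (v \* f)).

End CondExp.

Definition completely_alternating (R : realType) (phi : nat -> R) : Prop :=
  forall m n, (1 <= n)%N ->
    \sum_(i < n.+1) (-1) ^+ i * 'C(n, i)%:R * phi (m + i)%N <= 0.

(* A_n(x) = sum_(i <= n) (-1)^i C(n,i) x^i. *)
Definition Aseq (R : realType) (n : nat) (x : R) : R :=
  \sum_(i < n.+1) (-1) ^+ i * 'C(n, i)%:R * x ^+ i.

(* Main.v *)
From HB Require Import structures.
Require Import Defs.
From mathcomp Require Import all_boot all_order all_algebra.
From mathcomp Require Import complex.
From mathcomp Require Import all_classical all_reals all_analysis.
From mathcomp Require Import measurable_realfun.
From mathcomp Require Import ring lra.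

Set Implicit Arguments.
Unset Strict Implicit.
Unset Printing Implicit Defensive.

Import Order.TTheory GRing.Theory Num.Theory.
Import numFieldNormedType.Exports.

Local Open Scope classical_set_scope.
Local Open Scope ring_scope.
Local Open Scope complex_scope.

(** Write T for the operator f |-> E(vf). The point of the proof is that the
    hypotheses turn T into multiplication by v.

    Closedness of T makes E(|v|^2) finite almost everywhere. If it were infinite
    on a set Z of the subalgebra of positive finite measure, then, with
    q_n = E(|v|^2 1_{|v| < n}) increasing to +oo on Z, the functions
    f_n = conj(v) 1_{|v| < n} 1_Z / q_n would satisfy T f_n = 1_Z, while the
    integral of |f_n|^2 is that of 1_Z / q_n and tends to 0
    ([explosion_null]).

    Normality then makes v measurable for the subalgebra
    ([normal_multiplier_measurable]). If C is in the subalgebra, has finite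
    measure, and E(|v|^2) is bounded on C, then 1_C lies in the domain of T T^*
    and T T^* 1_C = E(|v|^2) 1_C. By normality 1_C also lies in the domain of
    T^* T with the same image, and pairing with 1_C gives
    ||E(v) 1_C|| = ||v 1_C||. The Pythagorean identity for conditional
    expectations ([condexp_pythagoras]) leaves no room for v - E(v) on C.

    Bounded functions that vanish off a set of the subalgebra, of finite measure
    and on which v is bounded, belong to the domain of every power of T. The
    hypothesis on E(|f|^2) therefore applies to the indicator of any measurable
    X inside such a set, and the same Pythagorean identity shows that on S(v)
    this indicator agrees with a function measurable for the subalgebra
    ([indic_version]). So on S(v) both sigma-algebras coincide up to null sets,
    E fixes the functions that vanish off S(v) ([version_supported]), and
    T f = v f on the domain of T ([cond_mul_op_mul]).

    Consequently Theta_n(f) is the integral of A_n(|v|^2) |f|^2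
    ([Theta_integral]), and testing with indicators of subsets of
    {A_n(|v|^2) > 0} shows that it is nonpositive on D(T^n) exactly when
    A_n(|v|^2) <= 0 almost everywhere ([Theta_le0_iff]). The alternating sums of
    |v|^(2(m+i)) are |v|^(2m) A_n(|v|^2), which gives both equivalences. *)


(** * Comparing functions through their integrals *)

Section Comparison.
Context (d : measure_display) (T : measurableType d) (R : realType).
Variable mu : {measure set T -> \bar R}.
Local Open Scope ereal_scope.

(** On a piece where g2 is bounded and g2 < g1, the integral of g2 is finite,
    so the positive difference g1 - g2 has integral 0 and the piece is null.
    Requiring the inequality of integrals only on these pieces lets the lemma
    serve both the full sigma-algebra and a subalgebra. *)
Lemma ae_le_of_integral (g1 g2 : T -> \bar R) (C : (set T)^nat) :
  measurable_fun [set: T] g1 -> measurable_fun [set: T] g2 ->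
  (forall t, 0 <= g1 t) -> (forall t, 0 <= g2 t) ->
  (forall n, measurable (C n)) -> (forall n, mu (C n) < +oo) ->
  \bigcup_n C n = [set: T] ->
  (forall n m : nat,
     let B := C n `&` ([set t | g2 t <= m%:R%:E] `&` [set t | g2 t < g1 t]) in
     \int[mu]_(t in B) g1 t <= \int[mu]_(t in B) g2 t) ->
  {ae mu, forall t, g1 t <= g2 t}.
Proof.
move=> mg1 mg2 g10 g20 mC Cfin CT H.
have mle m : measurable [set t | g2 t <= m%:R%:E].
  rewrite -[X in measurable X]setTI; exact: measurable_lee.
have mlt : measurable [set t | g2 t < g1 t].
  rewrite -[X in measurable X]setTI; exact: measurable_lte.
pose B n m := C n `&` ([set t | g2 t <= m%:R%:E] `&` [set t | g2 t < g1 t]).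
have mB n m : measurable (B n m) by apply: measurableI => //; exact: measurableI.
have Bnull n m : mu (B n m) = 0.
  have h2 : \int[mu]_(t in B n m) g2 t < +oo.
    apply: (@le_lt_trans _ _ (\int[mu]_(t in B n m) m%:R%:E)).
      apply: ge0_le_integral => //; first exact: measurable_funTS.
      by move=> t [_ []].
    rewrite integral_cst// lte_mul_pinfty ?lee_fin//.
    apply: le_lt_trans (Cfin n); apply: le_measure; rewrite ?inE//.
    by move=> t [].
  have h2fin : \int[mu]_(t in B n m) g2 t \is a fin_num.
    by rewrite ge0_fin_numE// integral_ge0.
  have fin2 t : B n m t -> g2 t \is a fin_num.
    move=> [_ [/= h _]]; rewrite ge0_fin_numE//; exact: le_lt_trans h (ltry _).
  have pos t : B n m t -> 0 < g1 t - g2 t.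
    by move=> Bt; rewrite sube_gt0 ?fin2//; case: Bt => _ [].
  have mdiff : measurable_fun (B n m) (g1 \- g2).
    by apply: emeasurable_funB; exact: measurable_funTS.
  have eq1 : \int[mu]_(t in B n m) g1 t =
      \int[mu]_(t in B n m) (g1 t - g2 t) + \int[mu]_(t in B n m) g2 t.
    rewrite -ge0_integralD//.
    - by apply: eq_integral => t; rewrite inE => Bt; rewrite subeK// fin2.
    - by move=> t Bt; exact/ltW/pos.
    - exact: measurable_funTS.
  have ge0 : 0 <= \int[mu]_(t in B n m) (g1 t - g2 t).
    by apply: integral_ge0 => t Bt; exact/ltW/pos.
  have eq0 : \int[mu]_(t in B n m) `| (g1 \- g2) t | = 0.
    rewrite (_ : \int[mu]_(t in B n m) `| (g1 \- g2) t | =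
              \int[mu]_(t in B n m) (g1 t - g2 t)).
      apply/eqP; rewrite eq_le ge0 andbT.
      have : \int[mu]_(t in B n m) g1 t <= \int[mu]_(t in B n m) g2 t := H n m.
      by rewrite eq1 -leeBrDr// subee.
    by apply: eq_integral => t; rewrite inE => Bt; rewrite gee0_abs//; exact/ltW/pos.
  have /(ae_eq_integral_abs mu (mB n m) mdiff)[N [mN muN sub]] := eq0.
  apply: (subset_measure0 _ mN _ muN) => // t Bt; apply: sub => /= /(_ Bt) h0.
  by have := pos _ Bt; rewrite /= in h0; rewrite h0 ltxx.
exists (\bigcup_n \bigcup_m B n m); split.
- by apply: bigcupT_measurable => n; exact: bigcupT_measurable.
- apply/negligibleP; first by apply: bigcupT_measurable => n; exact: bigcupT_measurable.
  apply: negligible_bigcup => n; apply: negligible_bigcup => m.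
  by apply/negligibleP; [exact: mB|exact: Bnull].
- move=> t /= /negP; rewrite -ltNge => lt12.
  have : [set: T] t by [].
  rewrite -CT => -[n _ Cnt]; exists n => //.
  have fin : g2 t \is a fin_num by rewrite ge0_fin_numE// (lt_le_trans lt12)// leey.
  exists (Num.truncn (fine (g2 t))).+1 => //; split => //; split => //=.
  by rewrite -(fineK fin) lee_fin ltW// truncnS_gt.
Qed.

End Comparison.

(** * Conditional expectation of an integrable function *)

Section NonnegativeCondexp.
Context (d : measure_display) (T : measurableType d) (R : realType).
Variable mu : {measure set T -> \bar R}.
Variable A : set (set T).
Hypothesis subA : sub_sigma_algebra_of A.
Hypothesis sfA : sigma_finite_on mu A.
Local Open Scope ereal_scope.
Local Notation gA := (g_sigma_algebraType A).

Lemma measurableAP (B : set gA) : measurable B <-> A B.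
Proof.
have E : <<s [set: T], A >> = A by apply: sigma_algebra_id; case: subA.
by rewrite (_ : A B = <<s [set: T], A >> B) // E.
Qed.

Lemma measurableA_sub B : A B -> d.-measurable B.
Proof. by case: subA => _; apply. Qed.

Lemma measurable_sub (d' : measure_display) (U : sigmaRingType d') (f : T -> U) :
  measurable_fun [set: gA] (f : gA -> U) -> measurable_fun [set: T] f.
Proof.
move=> mf _ Y mY; apply: measurableA_sub; apply/measurableAP.
exact: (mf measurableT Y mY).
Qed.

Lemma measurable_idA : measurable_fun [set: T] (id : T -> gA).
Proof.
by move=> _ Y mY; rewrite setTI; apply: measurableA_sub; exact/measurableAP.
Qed.

(** The restriction of mu to the subalgebra, on which the Radon-Nikodym theorem
    is used. *)
Definition traceA : set gA -> \bar R := fun B => mu B.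

Let traceA0 : traceA set0 = 0.
Proof. exact: measure0. Qed.
Let traceA_ge0 B : 0 <= traceA B.
Proof. exact: measure_ge0. Qed.
Let traceA_additive : semi_sigma_additive traceA.
Proof.
move=> F mF tF mUF; apply: (@measure_semi_sigma_additive _ _ _ mu) => //.
- by move=> i; apply: measurableA_sub; exact/measurableAP.
- by apply: measurableA_sub; exact/measurableAP.
Qed.
HB.instance Definition _ :=
  isMeasure.Build _ gA R traceA traceA0 traceA_ge0 traceA_additive.
Lemma exhaustionA : exists C : (set T)^nat,
  [/\ forall n, A (C n), forall n, mu (C n) < +oo, nondecreasing_seq C &
      \bigcup_n C n = [set: T] ].
Proof.
have [C [CT ndC HC]] := (@sigma_finiteP _ gA R [set: gA] traceA).1 sfA.
exists C; split => //.
- by move=> n; apply/measurableAP; case: (HC n).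
- by move=> n; case: (HC n).
Qed.

Lemma condexp_le (g1 g2 : T -> \bar R) :
  measurable_fun [set: gA] (g1 : gA -> \bar R) ->
  measurable_fun [set: gA] (g2 : gA -> \bar R) ->
  (forall t, 0 <= g1 t) -> (forall t, 0 <= g2 t) ->
  (forall B, A B -> \int[mu]_(t in B) g1 t <= \int[mu]_(t in B) g2 t) ->
  {ae mu, forall t, g1 t <= g2 t}.
Proof.
move=> mg1 mg2 g10 g20 H; have [C [AC Cfin _ CT]] := exhaustionA.
apply: (@ae_le_of_integral _ _ _ _ _ _ C) => //.
- exact: measurable_sub.
- exact: measurable_sub.
- by move=> n; exact/measurableA_sub.
- move=> n m /=; apply: H; apply/measurableAP.
  apply: measurableI; first exact/measurableAP.
  apply: (@measurableI _ gA).
  + by rewrite -[X in measurable X]setTI; exact: measurable_lee.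
  + by rewrite -[X in measurable X]setTI; exact: measurable_lte.
Qed.


HB.instance Definition _ := @Measure_isSigmaFinite.Build _ gA R traceA sfA.

Section Density.
Variable f : T -> R.
Hypothesis mf : measurable_fun [set: T] f.
Hypothesis f0 : forall t, (0 <= f t)%R.
Hypothesis foo : \int[mu]_t (f t)%:E < +oo.

(** The measure f mu restricted to the subalgebra; its density with respect to
    the restriction of mu is the conditional expectation of f. *)
Definition densityA (B : set gA) := \int[mu]_(t in B) (f t)%:E.
Let nu0 : densityA set0 = 0.
Proof. by rewrite /densityA integral_set0. Qed.
Let nuge0 B : 0 <= densityA B.
Proof. by apply: integral_ge0 => t _; rewrite lee_fin. Qed.
Let nuadd : semi_sigma_additive densityA.
Proof.
move=> F mF tF mUF.
apply: (@semi_sigma_additive_nng_induced _ T R mu (EFin \o f)) => //.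
- exact/measurable_EFinP.
- by move=> i; apply: measurableA_sub; exact/measurableAP.
- by apply: measurableA_sub; exact/measurableAP.
Qed.
HB.instance Definition _ := isMeasure.Build _ gA R densityA nu0 nuge0 nuadd.
Let nufin : fin_num_fun densityA.
Proof.
move=> B mB; rewrite ge0_fin_numE//; apply: le_lt_trans foo.
apply: ge0_subset_integral => //.
- by apply: measurableA_sub; exact/measurableAP.
- exact/measurable_EFinP.
- by move=> t _; rewrite lee_fin.
Qed.
HB.instance Definition _ := Measure_isFinite.Build _ gA R densityA nufin.

Lemma condexp_integrable_exists :
  exists g : T -> R, is_nncondexp mu A (EFin \o f) (EFin \o g).
Proof.
have dom : densityA `<< traceA.
  apply/null_content_dominatesP => B mB B0.
  rewrite /= /densityA; apply: null_set_integral => //.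
  - by apply: measurableA_sub; exact/measurableAP.
  - exact/measurable_funTS/measurable_EFinP.
have [g [g0 gfin gint gE]] := @radon_nikodym_sigma_finite _ gA R
  [the {sigma_finite_measure set gA -> \bar R} of traceA]
  [the {finite_measure set gA -> \bar R} of densityA] dom.
have mg : measurable_fun [set: gA] g := measurable_int _ gint.
have gK : EFin \o (fine \o g) = g by apply/funext => t /=; rewrite fineK.
exists (fine \o g); split; rewrite ?gK// => B AB.
have mB : measurable (B : set gA) by exact/measurableAP.
transitivity (\int[traceA]_(t in B) g t); first by rewrite -gE.
have := @ge0_integral_pushforward _ _ _ _ _ _ measurable_idA mu B g mB.
by apply => // ; exact: measurable_funTS.
Qed.
End Density.
End NonnegativeCondexp.

(** * Conditional expectation of a nonnegative function *)

Section NonnegativeCondexpTheory.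
Context (d : measure_display) (T : measurableType d) (R : realType).
Variable mu : {measure set T -> \bar R}.
Variable A : set (set T).
Hypothesis subA : sub_sigma_algebra_of A.
Hypothesis sfA : sigma_finite_on mu A.
Local Open Scope ereal_scope.
Local Notation gA := (g_sigma_algebraType A).
Local Notation measA := (measurableAP subA).

Lemma nncondexp_mono (f1 f2 g1 g2 : T -> \bar R) :
  measurable_fun [set: T] f1 -> measurable_fun [set: T] f2 ->
  (forall t, 0 <= f1 t) -> (forall t, 0 <= f2 t) ->
  {ae mu, forall t, f1 t <= f2 t} ->
  is_nncondexp mu A f1 g1 -> is_nncondexp mu A f2 g2 ->
  {ae mu, forall t, g1 t <= g2 t}.
Proof.
move=> mf1 mf2 f10 f20 f12 [mg1 g10 E1] [mg2 g20 E2].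
apply: (condexp_le subA sfA) => // B AB; rewrite -E1// -E2//.
apply: ae_ge0_le_integral => //.
- exact: measurableA_sub AB.
- exact: measurable_funTS.
- exact: measurable_funTS.
- by apply: filterS f12 => t.
Qed.

Lemma nncondexp_unique (f g1 g2 : T -> \bar R) :
  is_nncondexp mu A f g1 -> is_nncondexp mu A f g2 ->
  {ae mu, forall t, g1 t = g2 t}.
Proof.
move=> [mg1 g10 E1] [mg2 g20 E2].
have le12 : {ae mu, forall t, g1 t <= g2 t}.
  by apply: (condexp_le subA sfA) => // B AB; rewrite -E1// -E2.
have le21 : {ae mu, forall t, g2 t <= g1 t}.
  by apply: (condexp_le subA sfA) => // B AB; rewrite -E1// -E2.
by apply: filterS2 le12 le21 => t h1 h2; apply/eqP; rewrite eq_le h1 h2.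
Qed.

Lemma nncondexp_ae_eq (f g h : T -> \bar R) :
  measurable_fun [set: gA] (h : gA -> \bar R) -> (forall t, 0 <= h t) ->
  {ae mu, forall t, g t = h t} ->
  is_nncondexp mu A f g -> is_nncondexp mu A f h.
Proof.
move=> mh h0 gh [mg g0 E]; split => // B AB; rewrite E//.
apply: ge0_ae_eq_integral => //.
- exact: measurableA_sub AB.
- exact/measurable_funTS/(measurable_sub subA).
- exact/measurable_funTS/(measurable_sub subA).
- by apply: filterS gh => t.
Qed.

Lemma nncondexp_fine (f g : T -> \bar R) : is_nncondexp mu A f g ->
  {ae mu, forall t, g t < +oo} -> is_nncondexp mu A f (EFin \o (fine \o g)).
Proof.
move=> fg goo; have [mg g0 _] := fg; apply: nncondexp_ae_eq fg.
- by apply/measurable_EFinP; apply: (measurableT_comp _ mg); exact: fine_measurable.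
- by move=> t; rewrite /= lee_fin; exact: fine_ge0 (g0 t).
- by apply: filterS goo => t h; rewrite /= fineK// ge0_fin_numE.
Qed.

(** Lets a conditional expectation be assembled from those of the restrictions
    to the pieces of a countable measurable partition, by monotone convergence. *)
Lemma nncondexp_series (f : T -> \bar R) (F : (set T)^nat) (g : nat -> T -> \bar R) :
  measurable_fun [set: T] f -> (forall t, 0 <= f t) ->
  (forall n, measurable (F n)) -> trivIset setT F -> \bigcup_n F n = [set: T] ->
  (forall n, is_nncondexp mu A (f \_ (F n)) (g n)) ->
  is_nncondexp mu A f (fun t => \sum_(n <oo) g n t).
Proof.
move=> mf f0 mF tF FT H.
have mg n : measurable_fun [set: gA] (g n : gA -> \bar R) by case: (H n).
have g0 n t : 0 <= g n t by case: (H n).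
split => //.
- apply: (@ge0_emeasurable_sum _ gA R [set: gA] g xpredT) => //.
- by move=> t; exact: nneseries_ge0.
move=> B AB; have mB := measurableA_sub subA AB.
rewrite integral_nneseries//; last first.
  by move=> n; exact/measurable_funTS/(measurable_sub subA).
rewrite -[in LHS](setIT B) -FT setI_bigcupr ge0_integral_bigcup//=.
- by apply: eq_eseriesr => n _; rewrite integral_mkcondr; case: (H n) => _ _ ->.
- by move=> n; exact: measurableI.
- exact: measurable_funTS.
- exact: trivIset_setIl.
Qed.

(** The sets {f <= n}, cut by an exhaustion of finite measure, partition the
    space into pieces on which f is integrable. *)
Lemma nncondexp_exists (f : T -> R) : measurable_fun [set: T] f ->
  (forall t, (0 <= f t)%R) ->
  exists g : T -> \bar R, is_nncondexp mu A (EFin \o f) g.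
Proof.
move=> mf f0; have [C [AC Cfin ndC CT]] := exhaustionA subA sfA.
pose F := seqDU (fun n => C n `&` [set t | (f t <= n%:R)%R]).
have mF0 n : measurable (C n `&` [set t | (f t <= n%:R)%R]).
  apply: measurableI; first exact: measurableA_sub (AC n).
  by rewrite -[X in measurable X]setTI; exact: measurable_fun_le.
have mF n : measurable (F n) by exact: seqDU_measurable.
have FS n : F n `<=` C n `&` [set t | (f t <= n%:R)%R] by exact: subset_seqDU.
have FT : \bigcup_n F n = [set: T].
  rewrite -seqDU_bigcup_eq -subTset => t _.
  have : [set: T] t by [].
  rewrite -CT => -[n _ Cnt]; exists (maxn n (Num.truncn (f t)).+1) => //.
  split; first by move: Cnt; apply/subsetPset/ndC/leq_maxl.
  rewrite /= (le_trans (ltW (truncnS_gt _)))// ler_nat; exact: leq_maxr.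
have H n : exists g : T -> \bar R, is_nncondexp mu A ((EFin \o f) \_ (F n)) g.
  have [| | |g Hg] := @condexp_integrable_exists _ _ _ _ _ subA sfA (f \_ (F n)).
  - by apply/(measurable_restrictT _ _).1 => //; exact: measurable_funTS.
  - by move=> t; rewrite patchE; case: ifP.
  - apply: (@le_lt_trans _ _ (\int[mu]_(t in C n) n%:R%:E)).
      rewrite [leRHS]integral_mkcond; apply: ge0_le_integral => //=.
      + by move=> t _; rewrite patchE; case: ifP; rewrite lee_fin.
      + apply/measurable_EFinP/(measurable_restrictT _ _).1 => //.
        exact: measurable_funTS.
      + apply/(measurable_restrictT _ _).1 => //.
        exact: measurableA_sub (AC n).
      + move=> t _; rewrite !patchE; case: ifPn => [|_].
          by rewrite inE => /FS[Cnt ft]; rewrite mem_set// lee_fin.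
        by case: ifP; rewrite lee_fin.
    rewrite integral_cst; last exact: measurableA_sub (AC n).
    by rewrite lte_mul_pinfty// lee_fin.
  - exists (EFin \o g); congr (is_nncondexp mu A _ _): Hg.
    by apply/funext => t; rewrite /= !patchE; case: ifP.
have [g Hg] := choice H.
exists (fun t => \sum_(n <oo) g n t); apply: (nncondexp_series _ _ mF) => //.
- exact/measurable_EFinP.
- exact: trivIset_seqDU.
Qed.

Lemma nncondexpP (f : T -> R) : measurable_fun [set: T] f ->
  (forall t, (0 <= f t)%R) ->
  is_nncondexp mu A (EFin \o f) (nncondexp mu A (EFin \o f)).
Proof. by move=> mf f0; apply: xgetPex; exact: nncondexp_exists. Qed.

Lemma nncondexp_self (f : T -> R) : measurable_fun [set: gA] (f : gA -> R) ->
  (forall t, (0 <= f t)%R) -> is_nncondexp mu A (EFin \o f) (EFin \o f).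
Proof. by move=> mf f0; split => //; exact/measurable_EFinP. Qed.

Lemma nncondexpD (f1 f2 g1 g2 : T -> R) :
  measurable_fun [set: T] f1 -> measurable_fun [set: T] f2 ->
  (forall t, (0 <= f1 t)%R) -> (forall t, (0 <= f2 t)%R) ->
  is_nncondexp mu A (EFin \o f1) (EFin \o g1) ->
  is_nncondexp mu A (EFin \o f2) (EFin \o g2) ->
  is_nncondexp mu A (EFin \o (f1 \+ f2)%R) (EFin \o (g1 \+ g2)%R).
Proof.
move=> mf1 mf2 f10 f20 [/measurable_EFinP mg1 g10 E1] [/measurable_EFinP mg2 g20 E2].
split.
- exact/measurable_EFinP/measurable_funD.
- by move=> t; rewrite /= EFinD adde_ge0// ?g10 ?g20.
move=> B AB; have mB := measurableA_sub subA AB.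
under eq_integral do rewrite /= EFinD.
under [RHS]eq_integral do rewrite /= EFinD.
rewrite !ge0_integralD//; first by congr (_ + _); [exact: E1|exact: E2].
- by move=> t _; exact: g10.
- exact/measurable_funTS/measurable_EFinP/(measurable_sub subA).
- by move=> t _; exact: g20.
- exact/measurable_funTS/measurable_EFinP/(measurable_sub subA).
- by move=> t _; rewrite lee_fin.
- exact/measurable_funTS/measurable_EFinP.
- by move=> t _; rewrite lee_fin.
- exact/measurable_funTS/measurable_EFinP.
Qed.

End NonnegativeCondexpTheory.

(** * Pulling out a measurable factor *)

Section PullOut.
Context (d : measure_display) (T : measurableType d) (R : realType).
Variable mu : {measure set T -> \bar R}.
Variable A : set (set T).
Hypothesis subA : sub_sigma_algebra_of A.
Hypothesis sfA : sigma_finite_on mu A.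
Local Open Scope ereal_scope.
Local Notation gA := (g_sigma_algebraType A).
Local Notation measA := (measurableAP subA).

Import HBNNSimple.

(** Integration against a simple function measurable for the subalgebra only
    sees the integrals of u over sets of the subalgebra. *)
Let integral_nnsfunM (h : {nnsfun gA >-> R}) (B : set T) (u : T -> R) :
  A B -> measurable_fun [set: T] u -> (forall t, (0 <= u t)%R) ->
  \int[mu]_(t in B) (h t * u t)%:E =
  \sum_(y \in range h) (y%:E * \int[mu]_(t in B `&` h @^-1` [set y]) (u t)%:E).
Proof.
move=> AB mu_ u0; have mB := measurableA_sub subA AB.
have mh y : d.-measurable (h @^-1` [set y]).
  by apply: (measurableA_sub subA); apply/measA.
transitivity (\int[mu]_(t in B)
    (\sum_(y \in range h) (y%:E * ((u t)%:E * (\1_(h @^-1` [set y]) t)%:E)))).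
  apply: eq_integral => t _.
  rewrite [in LHS](fimfunE h) EFinM -fsumEFin// ge0_mule_fsuml.
    apply: eq_fsbigr => y _; rewrite EFinM -muleA; congr (_ * _).
    by rewrite muleC.
  by move=> y; exact: nnfun_muleindic_ge0.
have mui y : measurable_fun B (fun t => (u t)%:E * (\1_(h @^-1` [set y]) t)%:E).
  apply/measurable_funTS/emeasurable_funM; first exact/measurable_EFinP.
  exact/measurable_EFinP/measurable_indic.
have ui0 y t : 0 <= (u t)%:E * (\1_(h @^-1` [set y]) t)%:E.
  by rewrite mule_ge0// lee_fin.
rewrite ge0_integral_fsum//.
- apply: eq_fsbigr => y; rewrite inE => -[t0 _ <-].
  rewrite ge0_integralZl//; last by rewrite lee_fin.
  congr (_ * _); rewrite [RHS]integral_mkcondr; apply: eq_integral => t _.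
  by rewrite epatch_indic.
- by move=> y; exact: measurable_funeM.
- move=> y t Bt; have [[t0 _ <-]|ny] := pselect (range h y).
    by rewrite mule_ge0// lee_fin.
  rewrite indicE memNset ?mule0 ?mule0//.
  by move=> /= hty; apply: ny; exists t.
Qed.

(** By monotone approximation of p by simple functions measurable for the
    subalgebra. *)
Lemma nncondexpM (p f g : T -> R) :
  measurable_fun [set: gA] (p : gA -> R) -> (forall t, (0 <= p t)%R) ->
  measurable_fun [set: T] f -> (forall t, (0 <= f t)%R) ->
  is_nncondexp mu A (EFin \o f) (EFin \o g) ->
  is_nncondexp mu A (EFin \o (p \* f)%R) (EFin \o (p \* g)%R).
Proof.
move=> mp p0 mf f0 [/measurable_EFinP mg g0' E].
have g0 t : (0 <= g t)%R by have := g0' t; rewrite lee_fin.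
split.
- exact/measurable_EFinP/measurable_funM.
- by move=> t; rewrite lee_fin mulr_ge0.
move=> B AB; have mB := measurableA_sub subA AB.
have mBA : measurable (B : set gA) by exact/measA.
have mpB : measurable_fun (B : set gA) (EFin \o p : gA -> \bar R).
  exact/measurable_funTS/measurable_EFinP.
pose h := nnsfun_approx mBA mpB.
have approx (u : T -> R) : measurable_fun [set: T] u -> (forall t, (0 <= u t)%R) ->
    \int[mu]_(t in B) (p t * u t)%:E =
    lim (\int[mu]_(t in B) (h n t * u t)%:E @[n --> \oo]).
  move=> mu_ u0; have hu t : B t ->
      (p t * u t)%:E = lim ((h n t * u t)%:E @[n --> \oo]).
    move=> Bt; apply/esym/cvg_lim => //; under eq_fun do rewrite EFinM.
    rewrite EFinM; apply: cvgeZr => //.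
    by apply: (cvg_nnsfun_approx mBA mpB) => // s _; rewrite lee_fin.
  under eq_integral => t /[!inE] /hu -> //.
  apply: monotone_convergence => //.
  - move=> n; apply/measurable_funTS/measurable_EFinP/measurable_funM => //.
    exact: (@measurable_sub _ _ _ subA _ _ (h n)).
  - by move=> n t _; rewrite lee_fin mulr_ge0.
  - move=> t Bt a b ab; rewrite lee_fin ler_wpM2r//.
    by move: t {Bt}; apply/lefP; exact: (nd_nnsfun_approx mBA mpB).
rewrite /= !approx//; last exact: (measurable_sub subA).
rewrite (_ : (fun n => \int[mu]_(t in B) (h n t * f t)%:E) =
  (fun n => \int[mu]_(t in B) (h n t * g t)%:E))//.
apply/funext => n; rewrite !integral_nnsfunM//; last exact: (measurable_sub subA).
apply: eq_fsbigr => y _; congr (_ * _); apply: E.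
by apply/measA; apply: measurableI.
Qed.

End PullOut.

(** * Level sets, complex modulus and square integrability *)

Section RealLevelSets.
Context (d : measure_display) (T : measurableType d) (R : realType).
Implicit Types f g : T -> R.

Lemma measurable_set_ltr f g : measurable_fun [set: T] f ->
  measurable_fun [set: T] g -> measurable [set t | f t < g t].
Proof.
move=> mf mg.
have := measurable_fun_ltr mf mg measurableT (Y := [set true]) I.
by rewrite setTI; congr measurable; apply/seteqP; split.
Qed.

Lemma measurable_set_ler f g : measurable_fun [set: T] f ->
  measurable_fun [set: T] g -> measurable [set t | f t <= g t].
Proof.
by move=> mf mg; rewrite -[X in measurable X]setTI; exact: measurable_fun_le.
Qed.

(** The real inverse is the power with exponent -1, whose measurability is known. *)
Lemma measurable_invr f : measurable_fun [set: T] f -> (forall t, 0 <= f t) ->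
  measurable_fun [set: T] (fun t => (f t)^-1).
Proof.
move=> mf f0; rewrite (_ : (fun t => _) = fun t => f t `^ (-1)).
  exact: (measurableT_comp (measurable_powR (-1))).
by apply/funext => t; rewrite powR_inv1.
Qed.

End RealLevelSets.

Section ComplexModulus.
Context (R : realType).
Implicit Type z : R[i].

Lemma modc_ge0 z : 0 <= modc z.
Proof. by case: z => a b; exact: sqrtr_ge0. Qed.

Lemma sqr_modc z : modc z ^+ 2 = complex.Re z ^+ 2 + complex.Im z ^+ 2.
Proof. by case: z => a b; rewrite /modc /= sqr_sqrtr// addr_ge0// sqr_ge0. Qed.

Lemma modcM z1 z2 : modc (z1 * z2) = modc z1 * modc z2.
Proof. exact: ComplexField.Normc.normcM. Qed.

Lemma modc_conj z : modc (conjc z) = modc z.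
Proof. by case: z => a b; rewrite /modc /= sqrrN. Qed.

Lemma modc_real (r : R) : modc r%:C = `|r|.
Proof. by rewrite /modc /= expr0n /= addr0 sqrtr_sqr. Qed.

Lemma modc_eq0 z : (modc z == 0) = (z == 0).
Proof.
apply/eqP/eqP => [|->]; last exact: ComplexField.Normc.normc0.
exact: ComplexField.Normc.eq0_normc.
Qed.

Lemma modc0 : modc (0 : R[i]) = 0.
Proof. exact: ComplexField.Normc.normc0. Qed.

Lemma modcX z n : modc (z ^+ n) = modc z ^+ n.
Proof.
elim: n => [|n IH]; first by rewrite !expr0; exact: ComplexField.Normc.normc1.
by rewrite !exprS modcM IH.
Qed.

Lemma normRe_le z : `|complex.Re z| <= modc z.
Proof.
by rewrite -(ler_pXn2r (n := 2))// ?nnegrE ?modc_ge0// sqr_modc real_normK ?num_real// lerDl sqr_ge0.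
Qed.

Lemma normIm_le z : `|complex.Im z| <= modc z.
Proof.
by rewrite -(ler_pXn2r (n := 2))// ?nnegrE ?modc_ge0// sqr_modc real_normK ?num_real// lerDr sqr_ge0.
Qed.

Lemma modc_le_normD z : modc z <= `|complex.Re z| + `|complex.Im z|.
Proof.
rewrite -(ler_pXn2r (n := 2))// ?nnegrE ?modc_ge0 ?addr_ge0// sqr_modc.
rewrite sqrrD !real_normK ?num_real// lerD2r lerDl.
by rewrite mulrn_wge0// mulr_ge0.
Qed.

Lemma ReM z1 z2 : complex.Re (z1 * z2) =
  complex.Re z1 * complex.Re z2 - complex.Im z1 * complex.Im z2.
Proof. by case: z1 => a b; case: z2 => a' b'. Qed.

Lemma ImM z1 z2 : complex.Im (z1 * z2) =
  complex.Re z1 * complex.Im z2 + complex.Im z1 * complex.Re z2.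
Proof. by case: z1 => a b; case: z2 => a' b'. Qed.

Lemma ReJ z : complex.Re (conjc z) = complex.Re z. Proof. by case: z. Qed.
Lemma ImJ z : complex.Im (conjc z) = - complex.Im z. Proof. by case: z. Qed.

Lemma complex_ext z1 z2 : complex.Re z1 = complex.Re z2 ->
  complex.Im z1 = complex.Im z2 -> z1 = z2.
Proof. by case: z1 => a b; case: z2 => a' b' /= -> ->. Qed.

End ComplexModulus.

Section ComplexMeasurability.
Context (d : measure_display) (T : measurableType d) (R : realType).
Implicit Types f g : T -> R[i].

Lemma cmeasurableM f g : cmeasurable f -> cmeasurable g -> cmeasurable (f \* g).
Proof.
move=> [f1 f2] [g1 g2]; split.
  by under eq_fun do rewrite ReM; apply: measurable_funB; exact: measurable_funM.
by under eq_fun do rewrite ImM; apply: measurable_funD; exact: measurable_funM.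
Qed.

Lemma cmeasurable_conj f : cmeasurable f -> cmeasurable (fun t => conjc (f t)).
Proof.
move=> [f1 f2]; split; first by under eq_fun do rewrite ReJ.
by under eq_fun do rewrite ImJ; exact: measurableT_comp.
Qed.

Lemma cmeasurable_real (r : T -> R) : measurable_fun [set: T] r ->
  cmeasurable (fun t => (r t)%:C).
Proof. by move=> mr; split => //=; exact: measurable_cst. Qed.

Lemma measurable_modc f : cmeasurable f ->
  measurable_fun [set: T] (fun t => modc (f t)).
Proof.
move=> [f1 f2].
rewrite (_ : (fun t => modc (f t)) =
  fun t => Num.sqrt (complex.Re (f t) ^+ 2 + complex.Im (f t) ^+ 2)); last first.
  by apply/funext => t; rewrite -sqr_modc sqrtr_sqr ger0_norm// modc_ge0.
apply: (@measurableT_comp _ _ _ _ _ _ (@Num.sqrt R)).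
  exact: continuous_measurable_fun (@sqrt_continuous R).
by apply: measurable_funD; exact: measurable_funX.
Qed.

End ComplexMeasurability.

Section L2Basics.
Context (d : measure_display) (T : measurableType d) (R : realType).
Variable mu : {measure set T -> \bar R}.
Implicit Types f g : T -> R[i].

Lemma measurable_sqr_modc f : cmeasurable f ->
  measurable_fun [set: T] (fun t => ((modc (f t)) ^+ 2)%:E).
Proof. by move=> mf; apply/measurable_EFinP/measurable_funX/measurable_modc. Qed.

Lemma L2_le f (p : T -> R) : cmeasurable f -> measurable_fun [set: T] p ->
  {ae mu, forall t, modc (f t) ^+ 2 <= p t} ->
  (forall t, 0 <= p t) ->
  (\int[mu]_t (p t)%:E < +oo)%E -> L2 mu f.
Proof.
move=> mf mp fp p0 poo; split => //; apply: le_lt_trans poo.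
apply: ae_ge0_le_integral => //.
- by move=> t _; rewrite lee_fin sqr_ge0.
- exact: measurable_sqr_modc.
- by move=> t _; rewrite lee_fin.
- exact/measurable_EFinP.
- by apply: filterS fp => t h _; rewrite lee_fin.
Qed.

Lemma L2_ae_eq f g : cmeasurable g -> {ae mu, forall t, f t = g t} ->
  L2 mu f -> L2 mu g.
Proof.
move=> mg fg [mf foo]; apply: (L2_le (p := fun t => modc (f t) ^+ 2)) => //.
- exact/measurable_funX/measurable_modc.
- by apply: filterS fg => t ->.
- by move=> t; exact: sqr_ge0.
Qed.

Lemma l2norm_sqr f : l2norm mu f ^+ 2 = fine (\int[mu]_t ((modc (f t)) ^+ 2)%:E)%E.
Proof.
rewrite /l2norm sqr_sqrtr// /Rintegral fine_ge0// integral_ge0// => t _.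
by rewrite lee_fin sqr_ge0.
Qed.

End L2Basics.

(** * Finite versions and the conditional expectation of complex functions *)

Section ComplexCondexp.
Context (d : measure_display) (T : measurableType d) (R : realType).
Variable mu : {measure set T -> \bar R}.
Variable A : set (set T).
Hypothesis subA : sub_sigma_algebra_of A.
Hypothesis sfA : sigma_finite_on mu A.
Local Notation gA := (g_sigma_algebraType A).
Local Notation measA := (measurableAP subA).
(** [p ~> g] means that the finite-valued g is a version of the conditional
    expectation of the nonnegative function p. *)
Local Notation "f ~> g" := (is_nncondexp mu A (EFin \o f) (EFin \o g))
  (at level 70).
Implicit Types (p g u : T -> R) (f : T -> R[i]).

Lemma version_measurable p g : p ~> g -> measurable_fun [set: gA] (g : gA -> R).
Proof. by move=> [/measurable_EFinP]. Qed.

Lemma version_ge0 p g t : p ~> g -> 0 <= g t.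
Proof. by move=> [_ /(_ t)]; rewrite lee_fin. Qed.

Lemma version_fine p : measurable_fun [set: T] p -> (forall t, 0 <= p t) ->
  {ae mu, forall t, (nncondexp mu A (EFin \o p) t < +oo)%E} ->
  p ~> (fine \o nncondexp mu A (EFin \o p)).
Proof.
by move=> mp p0 poo; apply: nncondexp_fine => //; exact: nncondexpP.
Qed.

Lemma version_le p1 p2 g1 g2 : measurable_fun [set: T] p1 ->
  measurable_fun [set: T] p2 -> (forall t, 0 <= p1 t) -> (forall t, 0 <= p2 t) ->
  {ae mu, forall t, p1 t <= p2 t} -> p1 ~> g1 -> p2 ~> g2 ->
  {ae mu, forall t, g1 t <= g2 t}.
Proof.
move=> mp1 mp2 p10 p20 p12 h1 h2.
have : {ae mu, forall t, ((EFin \o g1) t <= (EFin \o g2) t)%E}.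
  apply: (nncondexp_mono subA sfA _ _ _ _ _ h1 h2).
  - exact/measurable_EFinP.
  - exact/measurable_EFinP.
  - by move=> t; rewrite lee_fin.
  - by move=> t; rewrite lee_fin.
  - by apply: filterS p12 => t; rewrite /= lee_fin.
by apply: filterS => t; rewrite /= lee_fin.
Qed.

(** Domination by a function whose conditional expectation is finite makes the
    canonical version finite almost everywhere, hence usable as a real function. *)
Lemma version_dom p u g : measurable_fun [set: T] p -> measurable_fun [set: T] u ->
  (forall t, 0 <= p t) -> (forall t, 0 <= u t) ->
  {ae mu, forall t, u t <= p t} -> p ~> g ->
  u ~> (fine \o nncondexp mu A (EFin \o u)).
Proof.
move=> mp mu_ p0 u0 up pg; apply: version_fine => //.
have hu := nncondexpP subA sfA mu_ u0.
have : {ae mu, forall t, (nncondexp mu A (EFin \o u) t <= (EFin \o g) t)%E}.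
  apply: (nncondexp_mono subA sfA _ _ _ _ _ hu pg).
  - exact/measurable_EFinP.
  - exact/measurable_EFinP.
  - by move=> t; rewrite lee_fin.
  - by move=> t; rewrite lee_fin.
  - by apply: filterS up => t; rewrite /= lee_fin.
by apply: filterS => t /le_lt_trans; apply; exact: ltry.
Qed.

Lemma version_int p g B : A B -> p ~> g ->
  (\int[mu]_(t in B) (p t)%:E = \int[mu]_(t in B) (g t)%:E)%E.
Proof. by move=> AB [_ _]; exact. Qed.

Lemma setTA : A [set: T]. Proof. by apply/measA. Qed.

Lemma nncondexp_version p g : measurable_fun [set: T] p -> (forall t, 0 <= p t) ->
  p ~> g -> {ae mu, forall t, nncondexp mu A (EFin \o p) t = (g t)%:E}.
Proof.
by move=> mp p0 h; apply: (nncondexp_unique subA sfA _ h); exact: nncondexpP.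
Qed.

Lemma rcondexp_measurable p : measurable_fun [set: T] p ->
  measurable_fun [set: gA] (rcondexp mu A p : gA -> R).
Proof.
move=> mp; apply: measurable_funB.
- apply: (measurableT_comp (@fine_measurable R setT _)) => //.
  have : is_nncondexp mu A (EFin \o p^\+) (nncondexp mu A (EFin \o p^\+)).
    by apply: nncondexpP => //; exact: measurable_funrpos.
  by case.
- apply: (measurableT_comp (@fine_measurable R setT _)) => //.
  have : is_nncondexp mu A (EFin \o p^\-) (nncondexp mu A (EFin \o p^\-)).
    by apply: nncondexpP => //; exact: measurable_funrneg.
  by case.
Qed.

Lemma rcondexp_eq p g1 g2 : measurable_fun [set: T] p ->
  p^\+ ~> g1 -> p^\- ~> g2 -> {ae mu, forall t, rcondexp mu A p t = g1 t - g2 t}.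
Proof.
move=> mp h1 h2.
have e1 := nncondexp_version (measurable_funrpos mp) (funrpos_ge0 p) h1.
have e2 := nncondexp_version (measurable_funrneg mp) (funrneg_ge0 p) h2.
by apply: filterS2 e1 e2 => t E1 E2; rewrite /rcondexp E1 E2.
Qed.

Lemma version0 : (cst 0 : T -> R) ~> cst 0.
Proof. by apply: nncondexp_self => // ; exact: measurable_cst. Qed.

Lemma rcondexp_ge0 p g : measurable_fun [set: T] p -> (forall t, 0 <= p t) ->
  p ~> g -> {ae mu, forall t, rcondexp mu A p t = g t}.
Proof.
move=> mp p0 pg.
have := @rcondexp_eq p g (cst 0) mp.
rewrite (_ : p^\+ = p); last by apply/funext => t; rewrite /funrpos; apply/max_idPl.
rewrite (_ : p^\- = cst 0); last first.
  by apply/funext => t; rewrite /funrneg; apply/max_idPr; rewrite oppr_le0.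
move=> /(_ pg version0); apply: filterS => t ->; by rewrite subr0.
Qed.

Lemma condexp_real p g : measurable_fun [set: T] p -> (forall t, 0 <= p t) ->
  p ~> g -> {ae mu, forall t, condexp mu A (fun s => (p s)%:C) t = (g t)%:C}.
Proof.
move=> mp p0 pg; have h1 := rcondexp_ge0 mp p0 pg.
have h2 : {ae mu, forall t, rcondexp mu A (cst 0) t = 0}.
  by have := rcondexp_ge0 _ _ version0; apply => //; exact: measurable_cst.
by apply: filterS2 h1 h2 => t E1 E2; rewrite /condexp /= E1 E2.
Qed.

Lemma cmeasurable_condexp f : cmeasurable f -> cmeasurable (condexp mu A f).
Proof.
move=> [m1 m2].
by split; apply: (measurable_sub subA); exact: rcondexp_measurable.
Qed.

Lemma conditionable_le f p g : cmeasurable f -> measurable_fun [set: T] p ->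
  (forall t, 0 <= p t) -> {ae mu, forall t, modc (f t) <= p t} ->
  p ~> g -> conditionable mu A f.
Proof.
move=> mf mp p0 fp pg; split => //.
have mm := measurable_modc mf.
have h := nncondexp_version mm (fun t => modc_ge0 _)
  (version_dom mp mm p0 (fun t => modc_ge0 _) fp pg).
by apply: filterS h => t /= ->; exact: ltry.
Qed.

Lemma conditionable_version f u : conditionable mu A f ->
  measurable_fun [set: T] u -> (forall t, 0 <= u t) ->
  (forall t, u t <= modc (f t)) -> u ~> (fine \o nncondexp mu A (EFin \o u)).
Proof.
move=> [mf foo] mu_ u0 uf.
have mm := measurable_modc mf.
apply: (version_dom mm) => //.
- by move=> t; exact: modc_ge0.
- exact: aeW.
- by apply: version_fine => // t; exact: modc_ge0.
Qed.

Lemma funrpos_le_norm p t : p^\+ t <= `|p t|.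
Proof. by rewrite /funrpos ge_max normr_ge0 ler_norm. Qed.

Lemma funrneg_le_norm p t : p^\- t <= `|p t|.
Proof. by rewrite /funrneg ge_max normr_ge0 -normrN ler_norm. Qed.

Lemma rcondexp_bound u p g : measurable_fun [set: T] u ->
  measurable_fun [set: T] p -> (forall t, 0 <= p t) ->
  {ae mu, forall t, `|u t| <= p t} -> p ~> g ->
  {ae mu, forall t, `|rcondexp mu A u t| <= g t}.
Proof.
move=> mu_ mp p0 up pg.
have upos : {ae mu, forall t, u^\+ t <= p t}.
  by apply: filterS up => t; apply: le_trans; exact: funrpos_le_norm.
have uneg : {ae mu, forall t, u^\- t <= p t}.
  by apply: filterS up => t; apply: le_trans; exact: funrneg_le_norm.
have mpos := measurable_funrpos mu_; have mneg := measurable_funrneg mu_.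
have vpos := version_dom mp mpos p0 (funrpos_ge0 u) upos pg.
have vneg := version_dom mp mneg p0 (funrneg_ge0 u) uneg pg.
have lpos := version_le mpos mp (funrpos_ge0 u) p0 upos vpos pg.
have lneg := version_le mneg mp (funrneg_ge0 u) p0 uneg vneg pg.
have E := rcondexp_eq mu_ vpos vneg.
apply: filterS3 E lpos lneg => t -> l1 l2.
have n1 := version_ge0 t vpos; have n2 := version_ge0 t vneg.
by rewrite ler_norml; apply/andP; split; lra.
Qed.

End ComplexCondexp.

(** * The Pythagorean identity *)

Section CondexpIntegral.
Context (d : measure_display) (T : measurableType d) (R : realType).
Variable mu : {measure set T -> \bar R}.
Variable A : set (set T).
Hypothesis subA : sub_sigma_algebra_of A.
Hypothesis sfA : sigma_finite_on mu A.
Local Notation gA := (g_sigma_algebraType A).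
Local Notation measA := (measurableAP subA).
Local Notation "f ~> g" := (is_nncondexp mu A (EFin \o f) (EFin \o g))
  (at level 70).
Implicit Types (p g u : T -> R) (f : T -> R[i]).

Lemma version_integrable p g C : measurable_fun [set: T] p -> (forall t, 0 <= p t) ->
  p ~> g -> A C -> mu.-integrable C (EFin \o p) -> mu.-integrable C (EFin \o g).
Proof.
move=> mp p0 pg AC /integrableP[_ ioo]; apply/integrableP; split.
  apply/measurable_funTS/measurable_EFinP/(measurable_sub subA).
  exact: version_measurable pg.
rewrite (_ : (\int[mu]_(t in C) `|(EFin \o g) t|)%E = (\int[mu]_(t in C) `|(EFin \o p) t|)%E)//.
rewrite (eq_integral (EFin \o g)); last first.
  by move=> t _; rewrite gee0_abs// lee_fin (version_ge0 _ pg).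
rewrite [RHS](eq_integral (EFin \o p)); last first.
  by move=> t _; rewrite gee0_abs// lee_fin.
by rewrite (version_int AC pg).
Qed.

Lemma rcondexp_integral p g1 g2 C : measurable_fun [set: T] p ->
  p^\+ ~> g1 -> p^\- ~> g2 -> A C -> mu.-integrable C (EFin \o p) ->
  (\int[mu]_(t in C) rcondexp mu A p t = \int[mu]_(t in C) p t)%R.
Proof.
move=> mp v1 v2 AC ip; have mC := measurableA_sub subA AC.
have mp1 := measurable_funrpos mp; have mp2 := measurable_funrneg mp.
have i1 : mu.-integrable C (EFin \o p^\+) by exact: integrable_funrpos.
have i2 : mu.-integrable C (EFin \o p^\-) by exact: integrable_funrneg.
have j1 := version_integrable mp1 (funrpos_ge0 p) v1 AC i1.
have j2 := version_integrable mp2 (funrneg_ge0 p) v2 AC i2.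
transitivity (\int[mu]_(t in C) (g1 t - g2 t))%R.
  rewrite /Rintegral; congr fine; apply: ae_eq_integral => //.
  - apply/measurable_funTS/measurable_EFinP/(measurable_sub subA).
    exact: rcondexp_measurable.
  - apply/measurable_funTS/measurable_EFinP/(measurable_sub subA).
    by apply: measurable_funB; apply: version_measurable; eassumption.
  - by apply: filterS (rcondexp_eq subA sfA mp v1 v2) => t ->.
rewrite RintegralB// [RHS](@eq_Rintegral _ _ _ mu C (p^\+ \- p^\-)); last first.
  by move=> t _; rewrite -[in LHS](funrposBneg p).
rewrite RintegralB//; congr (_ - _); rewrite /Rintegral; congr fine.
- by rewrite -(version_int AC v1).
- by rewrite -(version_int AC v2).
Qed.

(** Multiplying out (a - alpha)^2 leaves the cross term a alpha, whose integral is
    that of alpha^2 after pulling alpha out. The computation separates positive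
    and negative parts so that all integrands are nonnegative, and subtracts
    only at the end, when all terms but one are known to be finite. *)
Lemma condexp_pythagoras (a alpha g1 g2 : T -> R) : measurable_fun [set: T] a ->
  a^\+ ~> g1 -> a^\- ~> g2 ->
  measurable_fun [set: gA] (alpha : gA -> R) ->
  {ae mu, forall t, alpha t = g1 t - g2 t} ->
  (\int[mu]_t (a t ^+ 2)%:E < +oo)%E -> (\int[mu]_t (alpha t ^+ 2)%:E < +oo)%E ->
  (\int[mu]_t ((a t - alpha t) ^+ 2)%:E + \int[mu]_t (alpha t ^+ 2)%:E =
   \int[mu]_t (a t ^+ 2)%:E)%E.
Proof.
move=> ma v1 v2 malA alE a2 al2.
have mal : measurable_fun [set: T] alpha := measurable_sub subA malA.
pose x : T -> R := a^\+; pose y : T -> R := a^\-; pose z : T -> R := alpha^\+; pose w : T -> R := alpha^\-.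
have [mx my mz mw] : [/\ measurable_fun [set: T] x, measurable_fun [set: T] y,
    measurable_fun [set: T] z & measurable_fun [set: T] w].
  by split; [exact: measurable_funrpos|exact: measurable_funrneg|
             exact: measurable_funrpos|exact: measurable_funrneg].
have mzA : measurable_fun [set: gA] (z : gA -> R) by exact: measurable_funrpos.
have mwA : measurable_fun [set: gA] (w : gA -> R) by exact: measurable_funrneg.
have x0 t : 0 <= x t by exact: funrpos_ge0.
have y0 t : 0 <= y t by exact: funrneg_ge0.
have z0 t : 0 <= z t by exact: funrpos_ge0.
have w0 t : 0 <= w t by exact: funrneg_ge0.
have aE t : a t = x t - y t by rewrite -[in LHS](funrposBneg a).
have alphaE t : alpha t = z t - w t by rewrite -[in LHS](funrposBneg alpha).
have g10 t : 0 <= g1 t := version_ge0 t v1.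
have g20 t : 0 <= g2 t := version_ge0 t v2.
have mg1 : measurable_fun [set: T] g1 := measurable_sub subA (version_measurable v1).
have mg2 : measurable_fun [set: T] g2 := measurable_sub subA (version_measurable v2).
pose I (h : T -> R) := (\int[mu]_t (h t)%:E)%E.
have ID (h1 h2 : T -> R) : measurable_fun [set: T] h1 -> measurable_fun [set: T] h2 ->
    (forall t, 0 <= h1 t) -> (forall t, 0 <= h2 t) -> I (h1 \+ h2) = (I h1 + I h2)%E.
  move=> m1 m2 h10 h20; rewrite /I; under eq_integral do rewrite /= EFinD.
  rewrite ge0_integralD//; [by move=> t _; rewrite lee_fin| |
    by move=> t _; rewrite lee_fin|]; exact/measurable_EFinP.
have Iext (h1 h2 : T -> R) : h1 =1 h2 -> I h1 = I h2.
  by move=> E; apply: eq_integral => t _; rewrite E.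
have pull (b h g : T -> R) : measurable_fun [set: gA] (b : gA -> R) ->
    (forall t, 0 <= b t) -> measurable_fun [set: T] h -> (forall t, 0 <= h t) ->
    h ~> g -> I (b \* h) = I (b \* g).
  move=> mb b0 mh h0 hg.
  exact: (version_int (setTA subA) (nncondexpM subA mb b0 mh h0 hg)).
pose X := I ((z \* x) \+ (w \* y)); pose Y := I ((w \* x) \+ (z \* y)).
pose S := I (fun t => (a t - alpha t) ^+ 2).
pose P := I (fun t => a t ^+ 2); pose Q := I (fun t => alpha t ^+ 2).
have mprod (h1 h2 : T -> R) : measurable_fun [set: T] h1 -> measurable_fun [set: T] h2 ->
  measurable_fun [set: T] (h1 \* h2) by move=> *; exact: measurable_funM.
have pprod (h1 h2 : T -> R) : (forall t, 0 <= h1 t) -> (forall t, 0 <= h2 t) ->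
  forall t, 0 <= (h1 \* h2) t by move=> *; exact: mulr_ge0.
have psum (h1 h2 : T -> R) : (forall t, 0 <= h1 t) -> (forall t, 0 <= h2 t) ->
  forall t, 0 <= (h1 \+ h2) t by move=> *; exact: addr_ge0.
have msum (h1 h2 : T -> R) : measurable_fun [set: T] h1 -> measurable_fun [set: T] h2 ->
  measurable_fun [set: T] (h1 \+ h2) by move=> *; exact: measurable_funD.
have sq0 (h : T -> R) t : 0 <= (fun t => h t ^+ 2) t by exact: sqr_ge0.
have msq (h : T -> R) : measurable_fun [set: T] h ->
  measurable_fun [set: T] (fun t => h t ^+ 2) by move=> *; exact: measurable_funX.
have mdiff : measurable_fun [set: T] (fun t => a t - alpha t) by exact: measurable_funB.
have XE : X = I ((z \* g1) \+ (w \* g2)).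
  by rewrite /X !ID; auto; rewrite (pull z x g1)// (pull w y g2).
have YE : Y = I ((w \* g1) \+ (z \* g2)).
  by rewrite /Y !ID; auto; rewrite (pull w x g1)// (pull z y g2).
(* After pulling out z and w, this is alpha^2 = (z - w) (g1 - g2). *)
have XQY : X = (Q + Y)%E.
  rewrite XE YE /Q -ID; auto; apply: ge0_ae_eq_integral => //.
  - by apply/measurable_EFinP; apply: msum; exact: mprod.
  - apply/measurable_EFinP; apply: msum; first exact: msq.
    by apply: measurable_funD; apply: measurable_funM.
  - by move=> t _; rewrite lee_fin; apply: psum; auto.
  - by move=> t _; rewrite lee_fin; apply: (psum (fun t => alpha t ^+ 2)); auto.
  - apply: filterS alE => t alt _; congr EFin => /=.
    rewrite expr2 {1}alphaE alt; ring.
(* Pointwise, with a = x - y and alpha = z - w: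
   (a - alpha)^2 + 2 (z x + w y) = a^2 + alpha^2 + 2 (w x + z y). *)
have main : (S + (X + X) = P + Q + (Y + Y))%E.
  rewrite /S /X /P /Q /Y -!ID; auto 6; last by move=> t; exact: sqr_ge0.
  apply: Iext => t /=.
  by rewrite aE alphaE; ring.
have Yfin : (Y < +oo)%E.
  apply: (@le_lt_trans _ _ ((P + Q) + (P + Q))%E); last first.
    by apply: lte_add_pinfty; apply: lte_add_pinfty.
  rewrite /P /Q /Y -!ID; auto 6; apply: ge0_le_integral => //.
  - by move=> t _; rewrite lee_fin; apply: psum; auto.
  - by apply/measurable_EFinP; apply: msum; exact: mprod.
  - by apply/measurable_EFinP; apply: measurable_funD; apply: measurable_funD; exact: msq.
  - move=> t _; rewrite lee_fin /=.
    have hx : x t <= `|a t| := funrpos_le_norm a t.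
    have hy : y t <= `|a t| := funrneg_le_norm a t.
    have hz : z t <= `|alpha t| := funrpos_le_norm alpha t.
    have hw : w t <= `|alpha t| := funrneg_le_norm alpha t.
    have e1 : w t * x t <= `|alpha t| * `|a t| by apply: ler_pM.
    have e2 : z t * y t <= `|alpha t| * `|a t| by apply: ler_pM.
    have := sqr_ge0 (`|alpha t| - `|a t|); rewrite sqrrB !real_normK ?num_real//.
    by nra.
have I0 (h : T -> R) : (forall t, 0 <= h t) -> (0 <= I h)%E.
  by move=> h0; apply: integral_ge0 => t _; rewrite lee_fin.
have S0 : (0 <= S)%E by apply: I0 => t; exact: sqr_ge0.
have P0 : (0 <= P)%E by apply: I0 => t; exact: sqr_ge0.
have Q0 : (0 <= Q)%E by apply: I0 => t; exact: sqr_ge0.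
have Y0 : (0 <= Y)%E by apply: I0 => t; apply: psum; auto.
change (S + Q = P)%E; have Pfin : (P < +oo)%E := a2; have Qfin : (Q < +oo)%E := al2.
move: main; rewrite XQY; move: S0 P0 Q0 Y0 Yfin Pfin Qfin; clear.
move: S P Q Y => [s| |] [p| |] [q| |] [r| |] //=.
move=> _ _ _ _ _ _ _; rewrite -!EFinD => -[E]; congr EFin; lra.
Qed.

End CondexpIntegral.

(** * Truncations of the squared modulus of the multiplier *)

Section TruncatedSquare.
Context (d : measure_display) (T : measurableType d) (R : realType).
Variable mu : {measure set T -> \bar R}.
Variable A : set (set T).
Hypothesis subA : sub_sigma_algebra_of A.
Hypothesis sfA : sigma_finite_on mu A.
Local Notation gA := (g_sigma_algebraType A).
Local Notation "f ~> g" := (is_nncondexp mu A (EFin \o f) (EFin \o g))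
  (at level 70).

Definition truncated_sqr (v : T -> R[i]) (n : nat) (t : T) : R :=
  modc (v t) ^+ 2 * (modc (v t) < n%:R)%R%:R.


Lemma truncated_sqr_ge0 v n t : 0 <= truncated_sqr v n t.
Proof. by rewrite mulr_ge0// sqr_ge0. Qed.

Lemma measurable_truncation (v : T -> R[i]) (n : nat) : cmeasurable v ->
  measurable_fun [set: T] (fun t => (modc (v t) < n%:R)%R%:R : R).
Proof.
move=> mv; have mm := measurable_modc mv.
rewrite (_ : (fun t => _) = \1_[set t | modc (v t) < n%:R]).
  apply: measurable_indic; exact: measurable_set_ltr.
by apply/funext => t; rewrite indicE; congr (_ %:R); rewrite mem_setE.
Qed.

Lemma measurable_truncated_sqr (v : T -> R[i]) (n : nat) : cmeasurable v ->
  measurable_fun [set: T] (truncated_sqr v n).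
Proof.
move=> mv; apply: measurable_funM; last exact: measurable_truncation.
exact/measurable_funX/measurable_modc.
Qed.

(** The layers {n <= |v| < n + 1} give versions r_n of E(|v|^2 1_{layer}). Their
    partial sums are versions of the truncated second moments that increase
    everywhere, not just almost everywhere, to a version of E(|v|^2). *)
Lemma truncated_versions_exist (v : T -> R[i]) : cmeasurable v ->
  exists r : nat -> T -> R,
  [/\ forall n, measurable_fun [set: gA] (r n : gA -> R),
      forall n t, 0 <= r n t,
      forall n, truncated_sqr v n ~> (fun t => \sum_(i < n) r i t) &
      is_nncondexp mu A (fun t => (modc (v t) ^+ 2)%:E)
        (fun t => \sum_(i <oo) (r i t)%:E)%E].
Proof.
move=> mv; have mm := measurable_modc mv.
pose L (n : nat) := [set t | n%:R <= modc (v t) < n.+1%:R].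
have mL n : measurable (L n).
  rewrite (_ : L n = [set t | n%:R <= modc (v t)] `&` [set t | modc (v t) < n.+1%:R]).
    by apply: measurableI; [exact: measurable_set_ler|exact: measurable_set_ltr].
  by apply/seteqP; split => t; [move=> /andP[]|move=> [h1 h2]; apply/andP].
have LtruncP n t : L n t <-> Num.truncn (modc (v t)) = n.
  rewrite /L /=; split => [h|<-]; last by rewrite truncn_itv// modc_ge0.
  by apply: truncn_def.
pose s n := (fun t => modc (v t) ^+ 2) \_ (L n).
have ms n : measurable_fun [set: T] (s n).
  by apply/(measurable_restrictT _ _).1 => //; exact/measurable_funTS/measurable_funX.
have s0 n t : 0 <= s n t by rewrite /s patchE; case: ifP => // _; exact: sqr_ge0.
have sle n : {ae mu, forall t, s n t <= (n.+1%:R ^+ 2 : R)}.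
  apply: aeW => t; rewrite /s patchE; case: ifPn => [|_]; last by rewrite sqr_ge0.
  rewrite inE /L /= => /andP[_ /ltW h].
  by rewrite ler_pXn2r// ?nnegrE ?modc_ge0.
have cv n : (cst (n.+1%:R ^+ 2) : T -> R) ~> cst (n.+1%:R ^+ 2).
  by apply: nncondexp_self => // t /=; exact: sqr_ge0.
have hr n : exists g : T -> R, s n ~> g.
  eexists; apply: (version_dom subA sfA _ _ _ _ _ (cv n)) => //.
  by move=> t; exact: sqr_ge0.
have [r rP] := choice hr.
exists r; split.
- by move=> n; exact: version_measurable (rP n).
- by move=> n t; exact: version_ge0 (rP n).
- elim => [|n IH].
    rewrite (_ : (fun _ => _) = cst 0); last by apply/funext => t; rewrite big_ord0.
    rewrite (_ : truncated_sqr v 0 = cst 0); first exact: version0.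
    by apply/funext => t; rewrite /truncated_sqr ltNge modc_ge0 mulr0.
  have := nncondexpD subA (measurable_truncated_sqr n mv) (ms n)
    (fun t => truncated_sqr_ge0 v n t) (s0 n) IH (rP n).
  rewrite (_ : (truncated_sqr v n \+ s n) = truncated_sqr v n.+1); last first.
    apply/funext => t; rewrite /= /truncated_sqr /s patchE.
    case: ifPn; [rewrite inE|rewrite notin_setE]; rewrite /L /=.
      by move=> /andP[h1 ->]; rewrite ltNge h1 mulr0 add0r mulr1.
    move=> /negP; rewrite negb_and -ltNge -leNgt addr0 => /orP[h|h].
      by rewrite h (lt_trans h)// ltr_nat.
    by rewrite !ltNge h (le_trans _ h)// ler_nat.
  by rewrite (_ : (fun t => \sum_(i < n.+1) r i t) =
    (fun t => \sum_(i < n) r i t) \+ r n)//; apply/funext => t; rewrite big_ord_recr.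
- apply: (nncondexp_series subA _ _ mL) => //.
  + exact/measurable_EFinP/measurable_funX.
  + by move=> t; rewrite lee_fin sqr_ge0.
  + apply/trivIsetP => i j _ _ ij; rewrite -subset0 => t [/LtruncP h1 /LtruncP h2].
    by rewrite -h1 -h2 eqxx in ij.
  + rewrite -subTset => t _; exists (Num.truncn (modc (v t))) => //.
    exact/LtruncP.
  + move=> n; have := rP n; congr (is_nncondexp mu A _ _).
    by apply/funext => t; rewrite /s /= !patchE; case: ifP.
Qed.

End TruncatedSquare.

(** * Closedness bounds the conditional second moment *)

Section ClosedFiniteness.
Context (d : measure_display) (T : measurableType d) (R : realType).
Variable mu : {measure set T -> \bar R}.
Variable A : set (set T).
Hypothesis subA : sub_sigma_algebra_of A.
Hypothesis sfA : sigma_finite_on mu A.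
Variable v : T -> R[i].
Hypothesis mv : cmeasurable v.
Local Notation gA := (g_sigma_algebraType A).
Local Notation "f ~> g" := (is_nncondexp mu A (EFin \o f) (EFin \o g))
  (at level 70).
Local Notation measA := (measurableAP subA).

Lemma mulc_conj (z : R[i]) : z * conjc z = (modc z ^+ 2)%:C.
Proof.
apply: complex_ext; rewrite ?ReM ?ImM ?ReJ ?ImJ /= ?sqr_modc; ring.
Qed.

Lemma l2norm_ae0 (f : T -> R[i]) : cmeasurable f ->
  {ae mu, forall t, f t = 0} -> l2norm mu f = 0.
Proof.
move=> mf f0; rewrite /l2norm /Rintegral.
rewrite (_ : (\int[mu]_t ((modc (f t)) ^+ 2)%:E)%E = 0%E) ?sqrtr0//.
rewrite (ae_eq_integral (cst 0%E)) ?integral0//.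
- exact: measurable_sqr_modc.
- by apply: filterS f0 => t -> _; rewrite modc0 expr0n.
Qed.

Variable r : nat -> T -> R.
Hypothesis mr : forall n, measurable_fun [set: gA] (r n : gA -> R).
Hypothesis r0 : forall n t, 0 <= r n t.
Let q n t := \sum_(i < n) r i t.
Hypothesis rP : forall n, truncated_sqr v n ~> q n.

Let mq n : measurable_fun [set: gA] (q n : gA -> R).
Proof. by apply: measurable_sum => i; exact: mr. Qed.

Let q0 n t : 0 <= q n t.
Proof. by apply: sumr_ge0 => i _. Qed.

Let q_nd t : {homo q ^~ t : n m / (n <= m)%N >-> n <= m}.
Proof.
apply: homo_leq => [x //|x y z xy yz|n]; first exact: le_trans xy yz.
by rewrite /q big_ord_recr lerDl.
Qed.

(** The functions f_n = conj(v) 1_{|v| < n} 1_Z / q_n are mapped to 1_Z by the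
    operator, while their L^2 norms tend to 0 because q_n tends to +oo on Z. As
    the operator is closed, 1_Z is the image of 0. *)
Lemma explosion_null (Z : set T) (N : nat) : closed_operator mu (cond_mul_op mu A v) ->
  A Z -> (mu Z < +oo)%E -> (forall t, Z t -> 1 <= q N t) ->
  (forall t, Z t -> (\sum_(i <oo) (r i t)%:E = +oo)%E) -> mu Z = 0%E.
Proof.
move=> clT AZ Zfin Z1 Zoo; have mZ := measurableA_sub subA AZ.
have mZA : measurable (Z : set gA) by exact/measA.
pose b n t : R := \1_Z t * (q (n + N) t)^-1.
have mb n : measurable_fun [set: gA] (b n : gA -> R).
  apply: measurable_funM; first exact: measurable_indic.
  by apply: measurable_invr.
have b0 n t : 0 <= b n t by rewrite mulr_ge0// invr_ge0.
have q1 n t : Z t -> 1 <= q (n + N) t.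
  by move=> Zt; rewrite (le_trans (Z1 t Zt))// q_nd// leq_addl.
have bq n : (b n \* q (n + N)) = \1_Z.
  apply/funext => t; rewrite /b /= indicE; case: (boolP (t \in Z)); last by rewrite !mul0r.
  rewrite inE => /(q1 n) h; rewrite mul1r mulVf// gt_eqF//; lra.
have b_le n t : b n t <= \1_Z t.
  rewrite /b indicE; case: (boolP (t \in Z)); last by rewrite !mul0r.
  by rewrite inE => /(q1 n) h; rewrite mul1r invf_le1//; lra.
have mbT n : measurable_fun [set: T] (b n) := measurable_sub subA (mb n).
have mp n := measurable_truncated_sqr n mv.
have p0 n t := truncated_sqr_ge0 v n t.
pose f n t := conjc (v t) * ((modc (v t) < (n + N)%:R)%R%:R * b n t)%:C.
have mf n : cmeasurable (f n).
  apply: cmeasurableM; first exact: cmeasurable_conj.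
  by apply: cmeasurable_real; apply: measurable_funM => //; exact: measurable_truncation.
have vf n : v \* f n = fun t => (b n t * truncated_sqr v (n + N) t)%:C.
  apply/funext => t; rewrite /f /= mulrA mulc_conj /truncated_sqr -rmorphM /=.
  by congr (_%:C); ring.
have version1 n : (b n \* truncated_sqr v (n + N)) ~> \1_Z.
  by rewrite -(bq n); exact: nncondexpM.
have Tf n : {ae mu, forall t, condexp mu A (v \* f n) t = (\1_Z t)%:C}.
  rewrite vf; apply: (condexp_real subA sfA _ _ (version1 n)).
  - exact: measurable_funM.
  - by move=> t; exact: mulr_ge0.
have sqf n t : modc (f n t) ^+ 2 = b n t * b n t * truncated_sqr v (n + N) t.
  rewrite /f modcM modc_conj modc_real ger0_norm; last by rewrite mulr_ge0// ler0n.
  rewrite /truncated_sqr; case: (_ < _) => /=; ring.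
have intf n : (\int[mu]_t (modc (f n t) ^+ 2)%:E = \int[mu]_t (b n t)%:E)%E.
  under eq_integral do rewrite sqf.
  have mbb : measurable_fun [set: gA] ((b n \* b n) : gA -> R) by exact: measurable_funM.
  have bb0 t : 0 <= (b n \* b n) t by exact: mulr_ge0.
  have := version_int (setTA subA) (nncondexpM subA mbb bb0 (mp _) (p0 _) (rP (n + N))).
  move=> ->; apply: eq_integral => t _; congr EFin.
  rewrite /= -mulrA; have := congr1 (@^~ t) (bq n) => /= ->.
  rewrite /b indicE; case: (t \in Z); rewrite ?mulr1 ?mul0r ?mulr0//.
have intZ : (\int[mu]_t (\1_Z t)%:E = mu Z)%E by rewrite integral_indic// setIT.
have mindic : measurable_fun [set: T] (\1_Z : T -> R) by exact: measurable_indic.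
have L2Z : L2 mu (fun t => (\1_Z t)%:C).
  apply: (L2_le (p := \1_Z)) => //.
  - apply: aeW => t; rewrite modc_real indicE; case: (t \in Z) => /=.
      by rewrite normr1 expr1n.
    by rewrite normr0 expr0n.
  - by rewrite intZ.
have mc n : cmeasurable (condexp mu A (v \* f n)).
  by apply: (cmeasurable_condexp subA sfA); exact: cmeasurableM.
have intb n : (\int[mu]_t (b n t)%:E < +oo)%E.
  apply: le_lt_trans Zfin; rewrite -intZ; apply: ge0_le_integral => //.
  - by move=> t _; rewrite lee_fin.
  - exact/measurable_EFinP.
  - exact/measurable_EFinP.
  - by move=> t _; rewrite lee_fin.
have domf n : dom (cond_mul_op mu A v) (f n).
  split.
  - by split => //; rewrite intf.
  - apply: (conditionable_le subA sfA _ _ _ _ (version1 n)).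
    + exact: cmeasurableM.
    + exact: measurable_funM.
    + by move=> t; exact: mulr_ge0.
    + apply: aeW => t; have := congr1 (@^~ t) (vf n) => /= ->.
      by rewrite modc_real ger0_norm// mulr_ge0.
  - apply: L2_ae_eq L2Z => //.
    by apply: filterS (Tf n) => t ->.
have m0 : cmeasurable (fun=> 0 : R[i]) by split => /=; exact: measurable_cst.
have L20 : L2 mu (fun=> 0).
  split => //; under eq_integral do rewrite modc0 expr0n.
  by rewrite integral0.
have lim1 : (fun n => l2norm mu (f n \- (fun=> 0))) @ \oo --> (0 : R).
  have E n : l2norm mu (f n \- (fun=> 0)) = Num.sqrt (fine (\int[mu]_t (b n t)%:E)%E).
    rewrite /l2norm /Rintegral -intf; congr (Num.sqrt (fine _)).
    by apply: eq_integral => t _; rewrite /= subr0.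
  rewrite (_ : (fun n => _) = Num.sqrt \o (fine \o (fun n => (\int[mu]_t (b n t)%:E)%E))); last first.
    by apply/funext => n; rewrite /= E.
  rewrite -[X in _ --> X]sqrtr0; apply: continuous_cvg; first exact: sqrt_continuous.
  apply: fine_cvg.
  have [|||||_ _] := @dominated_convergence _ _ _ mu _ measurableT
    (fun n t => (b n t)%:E) (cst 0%E) (EFin \o \1_Z).
  - by move=> n; exact/measurable_EFinP.
  - exact: measurable_cst.
  - apply: aeW => t _ /=; have [Zt|nZt] := pselect (Z t); last first.
      rewrite (_ : (fun n => (b n t)%:E) = cst 0%E); first exact: cvg_cst.
      by apply/funext => n; rewrite /b indicE memNset//= mul0r.
    rewrite (_ : (fun n => (b n t)%:E) = EFin \o (fun n => (q (n + N) t)^-1)); last first.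
      by apply/funext => n; rewrite /= /b indicE mem_set//= mul1r.
    apply: cvg_EFin; first exact: nearW.
    apply/(gtr0_cvgV0 (f := fun n => q (n + N) t)).
      by apply: nearW => n; rewrite (lt_le_trans _ (q1 n t Zt)).
    rewrite (cvg_shiftn N (fun n => q n t)); apply/cvgeryP.
    have cv : cvgn (fun n => \sum_(0 <= i < n) (r i t)%:E)%E.
      by apply: is_cvg_nneseries => n _ _; rewrite lee_fin.
    rewrite (_ : (fun n => (q n t)%:E) = (fun n => \sum_(0 <= i < n) (r i t)%:E)%E).
      by rewrite -(Zoo t Zt).
    by apply/funext => n; rewrite sumEFin big_mkord.
  - apply/integrableP; split; first exact/measurable_EFinP.
    rewrite (eq_integral (EFin \o \1_Z)) ?intZ//.
    by move=> t _; rewrite gee0_abs// lee_fin.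
  - by apply: aeW => t n _; rewrite gee0_abs lee_fin.
  - by rewrite integral0.
have lim2 : (fun n => l2norm mu (oper (cond_mul_op mu A v) (f n) \-
    (fun t => (\1_Z t)%:C))) @ \oo --> (0 : R).
  rewrite (_ : (fun n => _) = cst 0); first exact: cvg_cst.
  apply/funext => n; apply: l2norm_ae0; last first.
    by apply: filterS (Tf n) => t /= ->; rewrite subrr.
  have [h1 h2] := mc n.
  split => /=; apply: measurable_funB => //.
(* The closed graph contains (0, 1_Z), so 1_Z = E(v 0) = 0. *)
have [_ [_ /= Z0]] := clT f _ _ domf L20 L2Z lim1 lim2.
have v0 : v \* (fun=> 0) = fun t => (cst 0 t : R)%:C.
  by apply/funext => t; rewrite /= mulr0.
have c0 : {ae mu, forall t, condexp mu A (v \* (fun=> 0)) t = 0}.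
  have H := condexp_real subA sfA (@measurable_cst _ _ T _ setT (0 : R)) (fun=> lexx _)
    (version0 mu A).
  by rewrite -v0 in H; apply: filterS H => t E; exact: E.
have nZ : {ae mu, forall t, ~ Z t}.
  apply: filterS2 Z0 c0 => t E1 E2 Zt.
  have := etrans E1 E2; rewrite indicE mem_set// => -[] /eqP.
  by rewrite oner_eq0.
have [N' [mN' muN' sub]] := nZ.
apply: (subset_measure0 _ mN' _ muN') => // t Zt; apply: sub => /=.
by apply.
Qed.

End ClosedFiniteness.

(** * Integrals and inner products of conditional expectations *)

Section NormalImpliesMeasurable.
Context (d : measure_display) (T : measurableType d) (R : realType).
Variable mu : {measure set T -> \bar R}.
Variable A : set (set T).
Hypothesis subA : sub_sigma_algebra_of A.
Hypothesis sfA : sigma_finite_on mu A.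
Variable v : T -> R[i].
Hypothesis cv : conditionable mu A v.
Let mv : cmeasurable v := proj1 cv.
Local Notation gA := (g_sigma_algebraType A).
Local Notation "f ~> g" := (is_nncondexp mu A (EFin \o f) (EFin \o g))
  (at level 70).
Local Notation measA := (measurableAP subA).
Local Notation EMv := (cond_mul_op mu A v).

(** If E(|v|^2) is infinite at t, some partial sum of its defining series is at
    least 1 at t, so that t lies in one of countably many null sets. *)
Lemma sqr_version_exists : closed_operator mu EMv ->
  exists Q : T -> R, (fun t => modc (v t) ^+ 2) ~> Q.
Proof.
move=> clT; have [r [mr r0 rP rS]] := truncated_versions_exist subA sfA mv.
have [C [AC Cfin _ CT]] := exhaustionA subA sfA.
pose g t := (\sum_(i <oo) (r i t)%:E)%E.
pose Z j N := C j `&` ([set t | g t = +oo%E] `&` [set t | 1 <= \sum_(i < N) r i t]).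
have mg : measurable_fun [set: gA] (g : gA -> \bar R) by case: rS.
have AZ j N : A (Z j N).
  apply/measA; apply: measurableI; first by apply/measA.
  apply: (@measurableI _ gA).
    by have := mg measurableT [set +oo%E] (emeasurable_set1 _); rewrite setTI.
  apply: (@measurable_set_ler _ gA R) => //.
  by apply: measurable_sum => i; exact: mr.
have Z0 j N : {ae mu, forall t, ~ Z j N t}.
  exists (Z j N); split; first exact: measurableA_sub (AZ j N).
    apply: (explosion_null subA sfA mv mr r0 rP (N := N) clT (AZ j N)).
    - apply: le_lt_trans (Cfin j); apply: le_measure; rewrite ?inE.
      + exact: measurableA_sub (AZ j N).
      + exact: measurableA_sub (AC j).
      + by move=> t [].
    - by move=> t [_ []].
    - by move=> t [_ []].
  by move=> t /contrapT.
have goo : {ae mu, forall t, (g t < +oo)%E}.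
  have : {ae mu, forall t, forall j N, ~ Z j N t}.
    by apply: ae_foralln => j; apply: ae_foralln => N; exact: Z0.
  apply: filterS => t nZ; rewrite ltey; apply/eqP => gt.
  have : [set: T] t by []. rewrite -CT => -[j _ Cjt].
  suff : (g t <= 1)%E by rewrite gt.
  apply: lime_le; first by apply: is_cvg_nneseries => n _ _; rewrite lee_fin.
  apply: nearW => N; rewrite sumEFin big_mkord lee_fin leNgt; apply/negP => h.
  by apply: (nZ j N); split => //; split => //; exact: ltW.
exists (fine \o g); exact: nncondexp_fine.
Qed.

Lemma inner_ae_l (f1 f2 g : T -> R[i]) : cmeasurable f1 -> cmeasurable f2 ->
  cmeasurable g -> {ae mu, forall t, f1 t = f2 t} -> inner mu f1 g = inner mu f2 g.
Proof.
move=> m1 m2 mg f12; have mc := cmeasurable_conj mg.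
have [r1 i1] := cmeasurableM m1 mc; have [r2 i2] := cmeasurableM m2 mc.
rewrite /inner /cintegral /Rintegral; congr (fine _ +i* fine _);
  (apply: ae_eq_integral => //; [exact/measurable_EFinP|exact/measurable_EFinP|]);
  by apply: filterS f12 => t ->.
Qed.

Lemma re_im_parts_version (f : T -> R[i]) : conditionable mu A f ->
  [/\ (fun t => complex.Re (f t))^\+ ~> fine \o nncondexp mu A (EFin \o (fun t => complex.Re (f t))^\+),
      (fun t => complex.Re (f t))^\- ~> fine \o nncondexp mu A (EFin \o (fun t => complex.Re (f t))^\-),
      (fun t => complex.Im (f t))^\+ ~> fine \o nncondexp mu A (EFin \o (fun t => complex.Im (f t))^\+) &
      (fun t => complex.Im (f t))^\- ~> fine \o nncondexp mu A (EFin \o (fun t => complex.Im (f t))^\-)].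
Proof.
move=> cf; have [[m1 m2] _] := cf; split;
  apply: (conditionable_version subA sfA cf);
  try exact: measurable_funrpos; try exact: measurable_funrneg;
  try exact: funrpos_ge0; try exact: funrneg_ge0; move=> t.
- exact: le_trans (funrpos_le_norm _ _) (normRe_le _).
- exact: le_trans (funrneg_le_norm _ _) (normRe_le _).
- exact: le_trans (funrpos_le_norm _ _) (normIm_le _).
- exact: le_trans (funrneg_le_norm _ _) (normIm_le _).
Qed.

(** This is the self-adjointness of the conditional expectation, tested against
    an indicator of the subalgebra. *)
Lemma condexp_cintegral (f : T -> R[i]) C : conditionable mu A f -> A C ->
  mu.-integrable C (EFin \o (fun t => complex.Re (f t))) ->
  mu.-integrable C (EFin \o (fun t => complex.Im (f t))) ->
  cintegral mu (fun t => condexp mu A f t * (\1_C t)%:C) =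
  cintegral mu (fun t => f t * (\1_C t)%:C).
Proof.
move=> cf AC i1 i2; have [[m1 m2] _] := cf.
have [v1 v2 v3 v4] := re_im_parts_version cf.
have e1 := rcondexp_integral subA sfA m1 v1 v2 AC i1.
have e2 := rcondexp_integral subA sfA m2 v3 v4 AC i2.
have patchM (h : T -> R) t : (h \_ C) t = h t * \1_C t.
  by rewrite patchE indicE; case: (t \in C); rewrite ?mulr1 ?mulr0.
rewrite /cintegral; congr (_ +i* _).
- transitivity (\int[mu]_(t in C) complex.Re (f t))%R.
    rewrite -e1 [RHS]Rintegral_mkcond; apply: eq_Rintegral => t _.
    by rewrite patchM ReM /= mulr0 subr0.
  rewrite [LHS]Rintegral_mkcond; apply: eq_Rintegral => t _.
  by rewrite patchM ReM /= mulr0 subr0.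
- transitivity (\int[mu]_(t in C) complex.Im (f t))%R.
    rewrite -e2 [RHS]Rintegral_mkcond; apply: eq_Rintegral => t _.
    by rewrite patchM ImM /= mulr0 add0r.
  rewrite [LHS]Rintegral_mkcond; apply: eq_Rintegral => t _.
  by rewrite patchM ImM /= mulr0 add0r.
Qed.

End NormalImpliesMeasurable.

(** * Normality makes the multiplier measurable *)

Section NormalOnSlices.
Context (d : measure_display) (T : measurableType d) (R : realType).
Variable mu : {measure set T -> \bar R}.
Variable A : set (set T).
Hypothesis subA : sub_sigma_algebra_of A.
Hypothesis sfA : sigma_finite_on mu A.
Variable v : T -> R[i].
Hypothesis cv : conditionable mu A v.
Let mv : cmeasurable v := proj1 cv.
Local Notation gA := (g_sigma_algebraType A).
Local Notation "f ~> g" := (is_nncondexp mu A (EFin \o f) (EFin \o g))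
  (at level 70).
Local Notation measA := (measurableAP subA).
Local Notation EMv := (cond_mul_op mu A v).

Lemma rcondexp_local (p g1 g2 : T -> R) (C : set T) :
  measurable_fun [set: T] p -> p^\+ ~> g1 -> p^\- ~> g2 -> A C ->
  {ae mu, forall t, C t -> rcondexp mu A (fun s => p s * \1_C s) t = rcondexp mu A p t}.
Proof.
move=> mp v1 v2 AC; have mC := measurableA_sub subA AC.
have mCA : measurable (C : set gA) by apply/measA.
have mi : measurable_fun [set: gA] (\1_C : gA -> R) by exact: measurable_indic.
have i0 t : 0 <= \1_C t :> R by rewrite indicE ler0n.
have w1 := nncondexpM subA mi i0 (measurable_funrpos mp) (funrpos_ge0 p) v1.
have w2 := nncondexpM subA mi i0 (measurable_funrneg mp) (funrneg_ge0 p) v2.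
have mpC : measurable_fun [set: T] (fun s => p s * \1_C s).
  by apply: measurable_funM => //; exact: measurable_indic.
have E1 : (fun s => p s * \1_C s)^\+ = \1_C \* p^\+.
  apply/funext => t; rewrite /funrpos /= indicE; case: (t \in C).
    by rewrite mulr1 mul1r.
  by rewrite mulr0 mul0r maxxx.
have E2 : (fun s => p s * \1_C s)^\- = \1_C \* p^\-.
  apply/funext => t; rewrite /funrneg /= indicE; case: (t \in C).
    by rewrite mulr1 mul1r.
  by rewrite mulr0 mul0r oppr0 maxxx.
rewrite -E1 in w1; rewrite -E2 in w2.
apply: filterS2 (rcondexp_eq subA sfA mpC w1 w2) (rcondexp_eq subA sfA mp v1 v2).
by move=> t -> -> Ct; rewrite /= indicE mem_set// !mul1r.
Qed.

Lemma integrable_of_bound (f : T -> R) (p : T -> R) (C : set T) : measurable C ->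
  measurable_fun [set: T] f -> measurable_fun [set: T] p ->
  (forall t, C t -> `|f t| <= p t) -> (\int[mu]_(t in C) (p t)%:E < +oo)%E ->
  mu.-integrable C (EFin \o f).
Proof.
move=> mC mf mp fp poo; apply/integrableP; split.
  exact/measurable_funTS/measurable_EFinP.
apply: le_lt_trans poo; apply: ge0_le_integral => //.
- by apply: measurableT_comp => //; exact/measurable_funTS/measurable_EFinP.
- exact/measurable_funTS/measurable_EFinP.
Qed.

Lemma ae0_of_int_sqr0 (f : T -> R) : measurable_fun [set: T] f ->
  (\int[mu]_t (f t ^+ 2)%:E = 0)%E -> {ae mu, forall t, f t = 0}.
Proof.
move=> mf f0.
have mf2 : measurable_fun [set: T] (fun t => (f t ^+ 2)%:E).
  exact/measurable_EFinP/measurable_funX.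
have : (\int[mu]_t `|(f t ^+ 2)%:E| = 0)%E.
  by rewrite -[RHS]f0; apply: eq_integral => t _; rewrite gee0_abs// lee_fin sqr_ge0.
move=> /(ae_eq_integral_abs mu measurableT mf2); apply: filterS => t /(_ I) [] /eqP.
by rewrite sqrf_eq0 => /eqP.
Qed.

Variable Q : T -> R.
Hypothesis vQ : (fun t => modc (v t) ^+ 2) ~> Q.
Variables (C : set T) (j : R).
Hypothesis AC : A C.
Hypothesis Cfin : (mu C < +oo)%E.
Hypothesis CQ : forall t, C t -> Q t <= j.

Let one (t : T) : R[i] := (\1_C t)%:C.
Let vb (t : T) : R[i] := conjc (v t) * one t.
Let sqv (t : T) := modc (v t) ^+ 2.
Let mC : d.-measurable C := measurableA_sub subA AC.
Let mindic : measurable_fun [set: T] (\1_C : T -> R). Proof. exact: measurable_indic. Qed.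
Let mindicA : measurable_fun [set: gA] (\1_C : gA -> R).
Proof. by apply: measurable_indic; apply/measA. Qed.
Let indic0 t : 0 <= \1_C t :> R. Proof. by rewrite indicE ler0n. Qed.
Let msqv : measurable_fun [set: T] sqv.
Proof. exact/measurable_funX/measurable_modc. Qed.
Let sqv0 t : 0 <= sqv t. Proof. exact: sqr_ge0. Qed.
Let Q0 t : 0 <= Q t := version_ge0 t vQ.
Let mQ : measurable_fun [set: T] Q := measurable_sub subA (version_measurable vQ).
Let versionC : (\1_C \* sqv) ~> (\1_C \* Q) := nncondexpM subA mindicA indic0 msqv sqv0 vQ.
Let indic_idem t : \1_C t ^+ 2 = \1_C t :> R.
Proof. by rewrite indicE; case: (t \in C); rewrite ?expr1n ?expr0n. Qed.

Let intC : (\int[mu]_t (\1_C t)%:E = mu C)%E.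
Proof. by rewrite integral_indic// setIT. Qed.

Let j0 : C !=set0 -> 0 <= j.
Proof. by move=> [t Ct]; rewrite (le_trans (Q0 t))// CQ. Qed.

Let QC t : \1_C t * Q t <= `|j| * \1_C t.
Proof.
rewrite indicE; case: (boolP (t \in C)); last by rewrite mul0r mulr0.
by rewrite inE => Ct; rewrite mul1r mulr1 (le_trans (CQ Ct))// ler_norm.
Qed.

Let int_const (c : R) : 0 <= c -> (\int[mu]_t (c * \1_C t)%:E < +oo)%E.
Proof.
move=> c0; under eq_integral do rewrite EFinM.
rewrite ge0_integralZl ?intC ?lte_mul_pinfty ?lee_fin//.
exact/measurable_EFinP.
Qed.

Let int_sqv : (\int[mu]_t ((\1_C \* sqv) t)%:E < +oo)%E.
Proof.
rewrite (version_int (setTA subA) versionC).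
apply: le_lt_trans (int_const (normr_ge0 j)); apply: ge0_le_integral => //.
- by move=> t _; rewrite lee_fin mulr_ge0.
- exact/measurable_EFinP/measurable_funM.
- exact/measurable_EFinP/measurable_funM.
- by move=> t _; rewrite lee_fin; exact: QC.
Qed.

Let mone : cmeasurable one. Proof. exact: cmeasurable_real. Qed.
Let mvb : cmeasurable vb.
Proof. by apply: cmeasurableM => //; exact: cmeasurable_conj. Qed.

Let sqone t : modc (one t) ^+ 2 = \1_C t.
Proof. by rewrite modc_real ger0_norm. Qed.

Let L2one : L2 mu one.
Proof.
by split => //; under eq_integral do rewrite sqone; rewrite intC.
Qed.

Let sqvb t : modc (vb t) ^+ 2 = (\1_C \* sqv) t.
Proof.
rewrite /vb modcM modc_conj exprMn sqone /= /sqv; ring.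
Qed.

Let L2vb : L2 mu vb.
Proof. by split => //; under eq_integral do rewrite sqvb. Qed.

Let vvb : v \* vb = fun t => ((\1_C \* sqv) t)%:C.
Proof.
apply/funext => t; rewrite /vb /= mulrA mulc_conj -/(sqv t) /one -rmorphM /=.
by rewrite mulrC.
Qed.

Let mprodv : measurable_fun [set: T] (\1_C \* sqv).
Proof. exact: measurable_funM. Qed.
Let prodv0 t : 0 <= (\1_C \* sqv) t.
Proof. by rewrite mulr_ge0. Qed.

Let TvbE : {ae mu, forall t, condexp mu A (v \* vb) t = ((\1_C \* Q) t)%:C}.
Proof. by rewrite vvb; exact: (condexp_real subA sfA mprodv prodv0 versionC). Qed.

Let domvb : dom EMv vb.
Proof.
split => //.
- apply: (conditionable_le subA sfA _ mprodv prodv0 _ versionC).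
    exact: cmeasurableM.
  apply: aeW => t; have := congr1 (@^~ t) vvb => /= ->.
  by rewrite modc_real ger0_norm// mulr_ge0.
- apply: (L2_le (p := fun t => j ^+ 2 * \1_C t)).
  + by apply: (cmeasurable_condexp subA sfA); exact: cmeasurableM.
  + exact: measurable_funM.
  + apply: filterS TvbE => t ->; rewrite modc_real real_normK ?num_real//=.
    rewrite exprMn indic_idem indicE; case: (boolP (t \in C)); last by rewrite mul0r mulr0.
    rewrite inE => Ct; rewrite mul1r mulr1 ler_sqr ?nnegrE//; first exact: CQ.
    by apply: j0; exists t.
  + by move=> t; rewrite mulr_ge0// sqr_ge0.
  + by apply: int_const; exact: sqr_ge0.
Qed.

(** T^* 1_C = conj(v) 1_C: both inner products are the integral of v f over C,
    which converges since |v f| <= |v|^2 + |f|^2. *)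
Let adj_one : adjoint_graph mu EMv (one, vb).
Proof.
split => //; split => // f [[mf f2] cvf _] /=.
have [[mr mi] _] := cvf.
have bound : (\int[mu]_(t in C) (sqv t + modc (f t) ^+ 2)%:E < +oo)%E.
  have msf := measurable_sqr_modc mf.
  under eq_integral do rewrite EFinD.
  rewrite ge0_integralD//; last 4 first.
  - by move=> t _; rewrite lee_fin.
  - exact/measurable_funTS/measurable_EFinP.
  - by move=> t _; rewrite lee_fin sqr_ge0.
  - exact/measurable_funTS.
  apply: lte_add_pinfty.
    apply: le_lt_trans int_sqv; rewrite integral_mkcond.
    under eq_integral do rewrite patchE.
    rewrite le_eqVlt; apply/orP; left; apply/eqP; apply: eq_integral => t _.
    by rewrite /= indicE; case: (t \in C); rewrite ?mul1r ?mul0r.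
  apply: le_lt_trans f2; apply: ge0_subset_integral => //.
  by move=> t _; rewrite lee_fin sqr_ge0.
have vfle t : modc ((v \* f) t) <= sqv t + modc (f t) ^+ 2.
  rewrite /= modcM /sqv; have := modc_ge0 (v t); have := modc_ge0 (f t).
  by have := sqr_ge0 (modc (v t) - modc (f t)); rewrite sqrrB; nra.
have mb : measurable_fun [set: T] (fun t => sqv t + modc (f t) ^+ 2).
  by apply: measurable_funD => //; exact/measurable_funX/measurable_modc.
have i1 : mu.-integrable C (EFin \o (fun t => complex.Re ((v \* f) t))).
  by apply: (integrable_of_bound mC mr mb _ bound) => t _; exact: le_trans (normRe_le _) _.
have i2 : mu.-integrable C (EFin \o (fun t => complex.Im ((v \* f) t))).
  by apply: (integrable_of_bound mC mi mb _ bound) => t _; exact: le_trans (normIm_le _) _.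
have := condexp_cintegral subA sfA cvf AC i1 i2.
have oneJ t : conjc (one t) = one t by exact: conjc_real.
rewrite /inner (_ : (fun t => condexp mu A (v \* f) t * conjc (one t)) =
  (fun t => condexp mu A (v \* f) t * (\1_C t)%:C)); last first.
  by apply/funext => t; rewrite oneJ.
move=> ->; congr cintegral; apply/funext => t.
have -> : conjc (vb t) = v t * one t.
  rewrite /vb; apply: complex_ext;
    by rewrite ?ReM ?ImM ?ReJ ?ImJ ?ReM ?ImM ?ReJ ?ImJ /=; ring.
by rewrite /one mulrA (mulrC (f t)).
Qed.

Hypothesis normal : comp_graph (adjoint_graph mu EMv) (graph mu EMv) =
  comp_graph (graph mu EMv) (adjoint_graph mu EMv).

(** T T^* 1_C = T (conj(v) 1_C) = E(|v|^2) 1_C, hence by normality T^* T 1_C is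
    the same function; its inner product with 1_C is the squared norm of
    T 1_C = E(v 1_C) on the one hand, and the integral of |v|^2 over C on the
    other. *)
Lemma normal_dom_indicator : dom EMv one /\
  (\int[mu]_t (modc (condexp mu A (v \* one) t) ^+ 2)%:E =
   \int[mu]_t ((\1_C \* sqv) t)%:E)%E.
Proof.
pose G := condexp mu A (v \* vb).
have [_ _ L2G] := domvb.
have : comp_graph (graph mu EMv) (adjoint_graph mu EMv) (one, G).
  exists vb; split; first exact: adj_one.
  by split; [exact: domvb|split => //; apply: aeW].
rewrite -normal => -[h [[domone [L2h /= hE]] [_ [_ adjh]]]].
split => //.
have mk : cmeasurable (condexp mu A (v \* one)).
  by apply: (cmeasurable_condexp subA sfA); exact: cmeasurableM.
have [mh hfin] := L2h.
have := adjh _ domone.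
rewrite /= (@inner_ae_l _ _ _ mu _ h); [|done|done|done|]; last first.
  by apply: filterS hE => t ->.
rewrite /inner /cintegral => -[hG _]; move: hG.
have sqh t : complex.Re (h t * conjc (h t)) = modc (h t) ^+ 2 by rewrite mulc_conj.
under eq_Rintegral do rewrite sqh.
rewrite /Rintegral => hG.
(* The inner product of 1_C with E(|v|^2) 1_C. *)
have eqG : (\int[mu]_t (complex.Re (one t * conjc (G t)))%:E =
   \int[mu]_t ((\1_C \* Q) t)%:E)%E.
  apply: ae_eq_integral => //.
  - have [mr _] := cmeasurableM mone (cmeasurable_conj L2G.1).
    exact/measurable_EFinP.
  - exact/measurable_EFinP/measurable_funM.
  - apply: filterS TvbE => t Gt _; rewrite /G Gt conjc_real /one -rmorphM /=.
    by rewrite mulrA -expr2 indic_idem.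
rewrite eqG -(version_int (setTA subA) versionC) in hG.
have eqk : (\int[mu]_t (modc (condexp mu A (v \* one) t) ^+ 2)%:E =
            \int[mu]_t (modc (h t) ^+ 2)%:E)%E.
  apply: ae_eq_integral => //; try exact: measurable_sqr_modc.
  by apply: filterS hE => t ->.
rewrite eqk -[LHS]fineK ?hG ?fineK//.
- by rewrite ge0_fin_numE// integral_ge0// => t _; rewrite lee_fin.
- by rewrite ge0_fin_numE// integral_ge0// => t _; rewrite lee_fin sqr_ge0.
Qed.

(** Since E(v 1_C) and v 1_C have the same norm, the Pythagorean identity, applied
    to the real and imaginary parts, shows that they are equal. *)
Lemma normal_eq_condexp_on : {ae mu, forall t, C t -> v t = condexp mu A v t}.
Proof.
have [[_ ck _] intk] := normal_dom_indicator.
have [v1 v2 v3 v4] := re_im_parts_version subA sfA ck.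
have [mvr mvi] := mv; have [[ma mb] _] := ck.
pose a t := complex.Re ((v \* one) t); pose b t := complex.Im ((v \* one) t).
pose alpha := rcondexp mu A a; pose beta := rcondexp mu A b.
have mal : measurable_fun [set: gA] (alpha : gA -> R) by exact: rcondexp_measurable.
have mbe : measurable_fun [set: gA] (beta : gA -> R) by exact: rcondexp_measurable.
have malT := measurable_sub subA mal; have mbeT := measurable_sub subA mbe.
have sumsq (x y : T -> R) : measurable_fun [set: T] x -> measurable_fun [set: T] y ->
    (\int[mu]_t (x t ^+ 2 + y t ^+ 2)%:E =
     \int[mu]_t (x t ^+ 2)%:E + \int[mu]_t (y t ^+ 2)%:E)%E.
  move=> mx my; under eq_integral do rewrite EFinD.
  rewrite ge0_integralD//.
  - by move=> t _; rewrite lee_fin sqr_ge0.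
  - exact/measurable_EFinP/measurable_funX.
  - by move=> t _; rewrite lee_fin sqr_ge0.
  - exact/measurable_EFinP/measurable_funX.
have eab : (\int[mu]_t (a t ^+ 2)%:E + \int[mu]_t (b t ^+ 2)%:E =
            \int[mu]_t ((\1_C \* sqv) t)%:E)%E.
  rewrite -sumsq//; apply: eq_integral => t _; congr EFin.
  by rewrite -sqr_modc /= modcM exprMn sqone /sqv mulrC.
have eal : (\int[mu]_t (alpha t ^+ 2)%:E + \int[mu]_t (beta t ^+ 2)%:E =
            \int[mu]_t ((\1_C \* sqv) t)%:E)%E.
  rewrite -sumsq// -intk; apply: eq_integral => t _; congr EFin.
  by rewrite sqr_modc.
have sq0 (x : T -> R) : (0 <= \int[mu]_t (x t ^+ 2)%:E)%E.
  by apply: integral_ge0 => t _; rewrite lee_fin sqr_ge0.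
have fin1 (x y : T -> R) : (\int[mu]_t (x t ^+ 2)%:E + \int[mu]_t (y t ^+ 2)%:E =
    \int[mu]_t ((\1_C \* sqv) t)%:E)%E -> (\int[mu]_t (x t ^+ 2)%:E < +oo)%E.
  by move=> E; apply: le_lt_trans int_sqv; rewrite -E leeDl.
have fa := fin1 _ _ eab; have fal := fin1 _ _ eal.
have fb : (\int[mu]_t (b t ^+ 2)%:E < +oo)%E by apply: (fin1 b a); rewrite addeC.
have fbe : (\int[mu]_t (beta t ^+ 2)%:E < +oo)%E by apply: (fin1 beta alpha); rewrite addeC.
have p1 := condexp_pythagoras subA ma v1 v2 mal (rcondexp_eq subA sfA ma v1 v2) fa fal.
have p2 := condexp_pythagoras subA mb v3 v4 mbe (rcondexp_eq subA sfA mb v3 v4) fb fbe.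
have [sa sb] : (\int[mu]_t ((a t - alpha t) ^+ 2)%:E = 0 /\
                \int[mu]_t ((b t - beta t) ^+ 2)%:E = 0)%E.
  have E : (\int[mu]_t (a t ^+ 2)%:E + \int[mu]_t (b t ^+ 2)%:E =
    \int[mu]_t (alpha t ^+ 2)%:E + \int[mu]_t (beta t ^+ 2)%:E)%E by rewrite eab eal.
  move: p1 p2 E fa fb fal fbe (sq0 a) (sq0 b) (sq0 alpha) (sq0 beta)
    (sq0 (fun t => a t - alpha t)) (sq0 (fun t => b t - beta t)).
  rewrite -/a -/b -/alpha -/beta.
  move: (\int[mu]_t (a t ^+ 2)%:E)%E (\int[mu]_t (b t ^+ 2)%:E)%E
    (\int[mu]_t (alpha t ^+ 2)%:E)%E (\int[mu]_t (beta t ^+ 2)%:E)%E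
    (\int[mu]_t ((a t - alpha t) ^+ 2)%:E)%E (\int[mu]_t ((b t - beta t) ^+ 2)%:E)%E.
  move=> [x| |] [y| |] [z| |] [w| |] [s| |] [u| |] //=.
  rewrite -!EFinD => -[e1] [e2] [e3] _ _ _ _; rewrite !lee_fin => *.
  by split; congr EFin; lra.
have za := ae0_of_int_sqr0 (measurable_funB ma malT) sa.
have zb := ae0_of_int_sqr0 (measurable_funB mb mbeT) sb.
have [w1 w2 w3 w4] := re_im_parts_version subA sfA cv.
have l1 := rcondexp_local mvr w1 w2 AC; have l2 := rcondexp_local mvi w3 w4 AC.
have ea : a = fun s => complex.Re (v s) * \1_C s.
  by apply/funext => t; rewrite /a /= ReM /= mulr0 subr0.
have eb : b = fun s => complex.Im (v s) * \1_C s.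
  by apply/funext => t; rewrite /b /= ImM /= mulr0 add0r.
rewrite -ea in l1; rewrite -eb in l2.
have l12 : {ae mu, forall t, C t -> condexp mu A v t = alpha t +i* beta t}.
  by apply: filterS2 l1 l2 => t h1 h2 Ct; rewrite /condexp -h1// -h2.
apply: filterS3 za zb l12 => t h1 h2 h3 Ct; rewrite h3//.
have i1 : \1_C t = 1 :> R by rewrite indicE mem_set.
apply: complex_ext => /=.
  by move: h1; rewrite /a /= ReM /= i1 mulr1 mulr0 subr0 => /eqP; rewrite subr_eq0 => /eqP.
by move: h2; rewrite /b /= ImM /= i1 mulr1 mulr0 add0r => /eqP; rewrite subr_eq0 => /eqP.
Qed.

End NormalOnSlices.

Section NormalMultiplier.
Context (d : measure_display) (T : measurableType d) (R : realType).
Variable mu : {measure set T -> \bar R}.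
Variable A : set (set T).
Hypothesis subA : sub_sigma_algebra_of A.
Hypothesis sfA : sigma_finite_on mu A.
Local Notation gA := (g_sigma_algebraType A).
Local Notation measA := (measurableAP subA).

(** The sets {Q <= m}, where Q is a finite version of E(|v|^2), exhaust the space. *)
Lemma normal_multiplier_measurable (v : T -> R[i]) : conditionable mu A v ->
  normal_operator mu (cond_mul_op mu A v) ->
  {ae mu, forall t, v t = condexp mu A v t}.
Proof.
move=> cv [_ clT normal].
have [Q vQ] := sqr_version_exists subA sfA cv clT.
have [C [AC Cfin _ CT]] := exhaustionA subA sfA.
pose D n m := C n `&` [set t | Q t <= m%:R].
have AD n m : A (D n m).
  apply/measA; apply: measurableI; first by apply/measA.
  apply: (@measurable_set_ler _ gA R) => //; exact: version_measurable vQ.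
have Dfin n m : (mu (D n m) < +oo)%E.
  apply: le_lt_trans (Cfin n); apply: le_measure; rewrite ?inE.
  - exact: measurableA_sub (AD n m).
  - exact: measurableA_sub (AC n).
  - by move=> t [].
have : {ae mu, forall t, forall n m, D n m t -> v t = condexp mu A v t}.
  apply: ae_foralln => n; apply: ae_foralln => m.
  apply: (normal_eq_condexp_on subA sfA cv vQ (AD n m) (Dfin n m) (j := m%:R)) => //.
  by move=> t [].
apply: filterS => t H; have : [set: T] t by []. rewrite -CT => -[n _ Cnt].
apply: (H n (Num.truncn (Q t)).+1); split => //=.
exact/ltW/truncnS_gt.
Qed.

End NormalMultiplier.

(** * The operator is a multiplication *)

Section Multiplication.
Context (d : measure_display) (T : measurableType d) (R : realType).
Variable mu : {measure set T -> \bar R}.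
Variable A : set (set T).
Hypothesis subA : sub_sigma_algebra_of A.
Hypothesis sfA : sigma_finite_on mu A.
Variable v : T -> R[i].
Hypothesis cv : conditionable mu A v.
Let mv : cmeasurable v := proj1 cv.
Local Notation gA := (g_sigma_algebraType A).
Local Notation "f ~> g" := (is_nncondexp mu A (EFin \o f) (EFin \o g))
  (at level 70).
Local Notation measA := (measurableAP subA).
Local Notation EMv := (cond_mul_op mu A v).
Local Notation w := (condexp mu A v).
Hypothesis vw : {ae mu, forall t, v t = w t}.

Let mmw : measurable_fun [set: gA] ((fun t => modc (w t)) : gA -> R).
Proof.
by apply: measurable_modc; split; apply: rcondexp_measurable => //; case: mv.
Qed.

Lemma slices_exist : exists D : (set T)^nat,
  [/\ forall n, A (D n), forall n, (mu (D n) < +oo)%E, \bigcup_n D n = [set: T] &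
      forall n t, D n t -> modc (w t) <= n%:R].
Proof.
have [C [AC Cfin ndC CT]] := exhaustionA subA sfA.
pose D n := C n `&` [set t | modc (w t) <= n%:R].
have AD n : A (D n).
  apply/measA; apply: measurableI; first by apply/measA.
  by apply: (@measurable_set_ler _ gA R).
exists D; split => //.
- move=> n; apply: le_lt_trans (Cfin n); apply: le_measure; rewrite ?inE.
  + exact: measurableA_sub (AD n).
  + exact: measurableA_sub (AC n).
  + by move=> t [].
- rewrite -subTset => t _; have : [set: T] t by [].
  rewrite -CT => -[n _ Cnt]; exists (maxn n (Num.truncn (modc (w t))).+1) => //.
  split; first by move: Cnt; apply/subsetPset/ndC/leq_maxl.
  rewrite /= (le_trans (ltW (truncnS_gt _)))// ler_nat; exact: leq_maxr.
- by move=> n t [].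
Qed.

(** Almost everywhere bounded functions supported in D: an explicit class of
    vectors that the operator preserves when v is bounded on D. *)
Definition bounded_on (D : set T) (f : T -> R[i]) := cmeasurable f /\
  exists2 M : R, 0 <= M & {ae mu, forall t, modc (f t) <= M * \1_D t}.

Section Slice.
Variables (D : set T) (m : R).
Hypothesis AD : A D.
Hypothesis Dfin : (mu D < +oo)%E.
Hypothesis Dm : forall t, D t -> modc (w t) <= m.

Let mD : d.-measurable D := measurableA_sub subA AD.
Let mindic : measurable_fun [set: T] (\1_D : T -> R). Proof. exact: measurable_indic. Qed.
Let indic0 t : 0 <= \1_D t :> R. Proof. by rewrite indicE ler0n. Qed.

Let mcst (M : R) : measurable_fun [set: T] (fun t => M * \1_D t).
Proof. exact: measurable_funM. Qed.

Let version_cst (M : R) : 0 <= M -> (fun t => M * \1_D t) ~> (fun t => M * \1_D t).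
Proof.
move=> M0; apply: nncondexp_self; last by move=> t; rewrite mulr_ge0.
apply: measurable_funM; first exact: measurable_cst.
by apply: measurable_indic; apply/measA.
Qed.

Lemma bounded_on_L2 f : bounded_on D f -> L2 mu f.
Proof.
move=> [mf [M M0 fM]]; apply: (L2_le (p := fun t => M ^+ 2 * \1_D t)) => //.
- apply: filterS fM => t h; have -> : M ^+ 2 * \1_D t = (M * \1_D t) ^+ 2.
    by rewrite exprMn indicE; case: (t \in D); rewrite ?expr1n ?expr0n.
  by rewrite ler_sqr ?nnegrE ?modc_ge0// mulr_ge0.
- by move=> t; rewrite mulr_ge0// sqr_ge0.
- under eq_integral do rewrite EFinM.
  rewrite ge0_integralZl ?integral_indic ?setIT ?lte_mul_pinfty ?lee_fin ?sqr_ge0//.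
  exact/measurable_EFinP.
Qed.

Lemma bounded_on_step f : bounded_on D f ->
  dom EMv f /\ bounded_on D (condexp mu A (v \* f)).
Proof.
move=> bf; have L2f := bounded_on_L2 bf; have [mf [M M0 fM]] := bf.
have mvf : cmeasurable (v \* f) by exact: cmeasurableM.
(* On D the modulus of v f is at most |m| M, and the real and imaginary parts
   of its conditional expectation inherit this bound. *)
pose M' := `|m| * M; have M'0 : 0 <= M' by rewrite mulr_ge0.
have vfM : {ae mu, forall t, modc ((v \* f) t) <= M' * \1_D t}.
  apply: filterS2 vw fM => t e h; rewrite /= e modcM.
  move: h; rewrite indicE; case: (boolP (t \in D)) => [|_]; rewrite ?mulr1 ?mulr0.
    rewrite inE => /Dm wm h; apply: ler_pM; rewrite ?modc_ge0//.
    exact: le_trans wm (ler_norm _).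
  by move=> h; rewrite (_ : modc (f t) = 0) ?mulr0//; apply/eqP; rewrite eq_le h modc_ge0.
have p0 t : 0 <= M' * \1_D t by rewrite mulr_ge0.
have cvf : conditionable mu A (v \* f).
  exact: (conditionable_le subA sfA mvf (mcst M') p0 vfM (version_cst M'0)).
have bT : bounded_on D (condexp mu A (v \* f)).
  split; first exact: cmeasurable_condexp.
  exists (2 * M'); first by rewrite mulr_ge0.
  have [mr mi] := mvf.
  have b1 : {ae mu, forall t, `|rcondexp mu A (fun t => complex.Re ((v \* f) t)) t| <= M' * \1_D t}.
    apply: (rcondexp_bound subA sfA mr (mcst M') p0 _ (version_cst M'0)).
    by apply: filterS vfM => t; apply: le_trans; exact: normRe_le.
  have b2 : {ae mu, forall t, `|rcondexp mu A (fun t => complex.Im ((v \* f) t)) t| <= M' * \1_D t}.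
    apply: (rcondexp_bound subA sfA mi (mcst M') p0 _ (version_cst M'0)).
    by apply: filterS vfM => t; apply: le_trans; exact: normIm_le.
  apply: filterS2 b1 b2 => t h1 h2; apply: le_trans (modc_le_normD _) _.
  by rewrite /condexp /= -mulrA mulr_natl mulr2n lerD.
by split => //; split => //; exact: bounded_on_L2.
Qed.

Lemma bounded_on_dom_pow n f : bounded_on D f -> dom_pow mu EMv n f.
Proof.
elim: n f => [|n IH] f bf /=; first exact: bounded_on_L2.
by have [df bT] := bounded_on_step bf; split => //; exact: IH.
Qed.

Lemma bounded_on_indic X : measurable X -> X `<=` D ->
  bounded_on D (fun t => (\1_X t)%:C).
Proof.
move=> mX XD; split; first by apply: cmeasurable_real; exact: measurable_indic.
exists 1 => //; apply: aeW => t; rewrite modc_real mul1r !indicE.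
case: (boolP (t \in X)) => [|_]; last by rewrite normr0.
by rewrite inE => /XD Dt; rewrite mem_set// normr1.
Qed.

Variable k : nat.
Hypothesis E_sq : forall f, dom_pow mu EMv k f ->
  {ae mu, forall t, v t != 0 -> ((modc (condexp mu A f t)) ^+ 2)%:E =
     nncondexp mu A (fun s => ((modc (f s)) ^+ 2)%:E) t}.

(** Let s be the indicator of S(v) and g a version of E(1_X). The hypothesis,
    applied to 1_X, reads g^2 = g on S(v), so s 1_X and its conditional
    expectation s g have the same norm and therefore coincide. *)
Lemma indic_version X : measurable X -> X `<=` D ->
  exists p : T -> R, [/\ measurable_fun [set: gA] (p : gA -> R), forall t, 0 <= p t &
    {ae mu, forall t, p t = \1_X t * (w t != 0)%:R}].
Proof.
move=> mX XD.
have mi : measurable_fun [set: T] (\1_X : T -> R) by exact: measurable_indic.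
have i0 t : 0 <= \1_X t :> R by rewrite indicE ler0n.
pose s t : R := (w t != 0)%:R.
have sE : s = \1_[set t | w t != 0].
  by apply/funext => t; rewrite indicE; congr (_ %:R); rewrite mem_setE.
have ms : measurable_fun [set: gA] (s : gA -> R).
  rewrite sE; apply: measurable_indic.
  rewrite (_ : [set t | w t != 0] = [set t | cst 0 t < modc (w t)]).
    exact: (@measurable_set_ltr _ gA R).
  apply/funext => t; rewrite /mkset /cst; congr is_true.
  by rewrite lt0r modc_eq0 modc_ge0 andbT.
have msT := measurable_sub subA ms.
have s0 t : 0 <= s t by rewrite ler0n.
have s2 t : s t ^+ 2 = s t by rewrite /s; case: (_ != _); rewrite ?expr1n ?expr0n.
have intX : (\int[mu]_t (\1_X t)%:E < +oo)%E.
  rewrite integral_indic// setIT; apply: le_lt_trans Dfin.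
  by apply: le_measure; rewrite ?inE.
have [g Xg] := condexp_integrable_exists subA sfA mi i0 intX.
have mg := version_measurable Xg; have g0 t : 0 <= g t := version_ge0 t Xg.
have mgT := measurable_sub subA mg.
have sg := nncondexpM subA ms s0 mi i0 Xg.
have sq1 t : modc (\1_X t)%:C ^+ 2 = \1_X t :> R.
  by rewrite modc_real ger0_norm// indicE; case: (_ \in _); rewrite ?expr1n ?expr0n.
have gg : {ae mu, forall t, s t * g t ^+ 2 = s t * g t}.
  have h1 := E_sq (bounded_on_dom_pow k (bounded_on_indic mX XD)).
  have h2 := condexp_real subA sfA mi i0 Xg.
  have h3 := nncondexp_version subA sfA mi i0 Xg.
  have h4 : {ae mu, forall t, v t != 0 -> g t ^+ 2 = g t}.
    apply: filterS3 h1 h2 h3 => t e1 e2 e3 /e1; rewrite e2 modc_real ger0_norm//.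
    rewrite (_ : (fun s => _) = EFin \o \1_X) ?e3; first by move=> [].
    by apply/funext => x /=; rewrite sq1.
  apply: filterS2 vw h4 => t e; rewrite /s -e.
  by case: eqP => [_ _|_ h]; [rewrite !mul0r|rewrite h].
have mprod : measurable_fun [set: T] (s \* \1_X) by exact: measurable_funM.
have prod0 t : 0 <= (s \* \1_X) t by rewrite mulr_ge0.
have pos : (s \* \1_X)^\+ = s \* \1_X.
  by apply/funext => t; rewrite /funrpos; apply/max_idPl.
have neg : (s \* \1_X)^\- = cst 0.
  by apply/funext => t; rewrite /funrneg; apply/max_idPr; rewrite oppr_le0.
have mq : measurable_fun [set: gA] ((s \* g) : gA -> R) by exact: measurable_funM.
have v1 : (s \* \1_X)^\+ ~> s \* g by rewrite pos.
have v2 : (s \* \1_X)^\- ~> cst 0 by rewrite neg; exact: version0.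
have e1 : (\int[mu]_t ((s \* \1_X) t ^+ 2)%:E = \int[mu]_t ((s \* \1_X) t)%:E)%E.
  apply: eq_integral => t _; congr EFin.
  by rewrite /= exprMn s2 indicE; case: (_ \in _); rewrite ?expr1n ?expr0n.
have e2 : (\int[mu]_t ((s \* g) t ^+ 2)%:E = \int[mu]_t ((s \* \1_X) t)%:E)%E.
  rewrite (version_int (setTA subA) sg); apply: ge0_ae_eq_integral => //.
  - apply/measurable_EFinP/measurable_funX; exact: measurable_funM.
  - by apply/measurable_EFinP; exact: measurable_funM.
  - by move=> t _; rewrite lee_fin sqr_ge0.
  - by move=> t _; rewrite lee_fin mulr_ge0.
  - by apply: filterS gg => t h _; rewrite /= exprMn s2 h.
have intsX : (\int[mu]_t ((s \* \1_X) t)%:E < +oo)%E.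
  apply: le_lt_trans intX; apply: ge0_le_integral => //.
  - by move=> t _; rewrite lee_fin.
  - exact/measurable_EFinP.
  - exact/measurable_EFinP.
  - by move=> t _; rewrite lee_fin /= /s; case: (_ != _); rewrite ?mul1r ?mul0r.
have alE : {ae mu, forall t, (s \* g) t = (s \* g) t - cst 0 t}.
  by apply: aeW => t; rewrite subr0.
have := condexp_pythagoras subA mprod v1 v2 mq alE.
rewrite e1 e2 => /(_ intsX intsX) pyth.
have int0 : (\int[mu]_t (((s \* \1_X) t - (s \* g) t) ^+ 2)%:E = 0)%E.
  have I0 : (0 <= \int[mu]_t ((s \* \1_X) t)%:E)%E.
    by apply: integral_ge0 => t _; rewrite lee_fin.
  move: pyth I0 intsX; move: (integral _ _ _) (integral _ _ _) => [x| |] [y| |] //=.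
  by rewrite -EFinD => -[e] _ _; congr EFin; lra.
exists (s \* g); split => //; first by move=> t; rewrite mulr_ge0.
have md : measurable_fun [set: T] (fun t => (s \* \1_X) t - (s \* g) t).
  by apply: measurable_funB => //; exact: measurable_sub mq.
have := ae0_of_int_sqr0 md int0; apply: filterS => t /eqP; rewrite subr_eq0 => /eqP <-.
by rewrite /= /s mulrC.
Qed.

End Slice.

Variable k : nat.
Hypothesis E_sq : forall f, dom_pow mu EMv k f ->
  {ae mu, forall t, v t != 0 -> ((modc (condexp mu A f t)) ^+ 2)%:E =
     nncondexp mu A (fun s => ((modc (f s)) ^+ 2)%:E) t}.

(** On S(v) every measurable set agrees with a set of the subalgebra, so u and its
    conditional expectation g have the same integral over every measurable set
    of a slice; off S(v) both vanish. *)
Lemma version_supported (u g : T -> R) : measurable_fun [set: T] u ->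
  (forall t, 0 <= u t) -> {ae mu, forall t, w t = 0 -> u t = 0} -> u ~> g ->
  {ae mu, forall t, g t = u t}.
Proof.
move=> mu_ u0 uw ug.
have mgA := version_measurable ug; have g0 t : 0 <= g t := version_ge0 t ug.
have mg := measurable_sub subA mgA.
pose c t : R := (w t == 0)%:R.
have mc : measurable_fun [set: gA] (c : gA -> R).
  rewrite (_ : c = \1_[set t | modc (w t) <= cst 0 t]).
    by apply: measurable_indic; exact: (@measurable_set_ler _ gA R).
  apply/funext => t; rewrite indicE /c; congr (nat_of_bool _)%:R.
  apply/idP/idP => [/eqP h|]; rewrite inE /mkset; first by rewrite h modc0.
  by move=> h; rewrite -modc_eq0 eq_le h modc_ge0.
have c0 t : 0 <= c t by rewrite ler0n.
have cg := nncondexpM subA mc c0 mu_ u0 ug.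
have gw : {ae mu, forall t, w t = 0 -> g t = 0}.
  have : {ae mu, forall t, (c \* g) t <= cst 0 t}.
    apply: (version_le subA sfA _ _ _ _ _ cg (version0 mu A)) => //.
    - by apply: measurable_funM => //; exact: measurable_sub mc.
    - by move=> t; rewrite mulr_ge0.
    - apply: filterS uw => t h; rewrite /= /c; case: eqP => [/h ->|_]; first by rewrite mulr0.
      by rewrite mul0r.
  apply: filterS => t h w0; apply/eqP; rewrite eq_le g0 andbT.
  by move: h; rewrite /= /c w0 eqxx mul1r.
have [D [AD Dfin DT Dw]] := slices_exist.
have intX n X : measurable X -> X `<=` D n ->
    (\int[mu]_(t in X) (u t)%:E = \int[mu]_(t in X) (g t)%:E)%E.
  move=> mX XD; have [p [mp p0 pE]] := indic_version (AD n) (Dfin n) (Dw n) E_sq mX XD.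
  have mpT := measurable_sub subA mp.
  have E (h : T -> R) : measurable_fun [set: T] h -> (forall t, 0 <= h t) ->
      {ae mu, forall t, w t = 0 -> h t = 0} ->
      (\int[mu]_(t in X) (h t)%:E = \int[mu]_t ((p \* h) t)%:E)%E.
    move=> mh h0 hw; rewrite integral_mkcond; apply: ge0_ae_eq_integral => //.
    - apply/(measurable_restrictT _ _).1 => //.
      exact/measurable_funTS/measurable_EFinP.
    - exact/measurable_EFinP/measurable_funM.
    - by move=> t _; rewrite patchE; case: ifP; rewrite ?lee_fin.
    - by move=> t _; rewrite lee_fin mulr_ge0.
    - apply: filterS2 pE hw => t pt ht _; rewrite patchE /= pt indicE.
      case: eqP => [/ht ->|_]; first by case: ifP; rewrite ?mulr0.
      by case: ifP; rewrite ?mul1r ?mulr1 ?mul0r.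
  rewrite !E//; exact: (version_int (setTA subA) (nncondexpM subA mp p0 mu_ u0 ug)).
have mEu : measurable_fun [set: T] (EFin \o u) by exact/measurable_EFinP.
have mEg : measurable_fun [set: T] (EFin \o g) by exact/measurable_EFinP.
have mDn n : measurable (D n) := measurableA_sub subA (AD n).
have le1 : {ae mu, forall t, (EFin \o g) t <= (EFin \o u) t}%E.
  apply: (ae_le_of_integral (C := D)) => //.
  move=> n m' /=; rewrite -(intX n)//.
  apply: measurableI => //; apply: measurableI.
    by rewrite -[X in measurable X]setTI; exact: measurable_lee.
  by rewrite -[X in measurable X]setTI; exact: measurable_lte.
have le2 : {ae mu, forall t, (EFin \o u) t <= (EFin \o g) t}%E.
  apply: (ae_le_of_integral (C := D)) => //.
  move=> n m' /=; rewrite (intX n)//.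
  apply: measurableI => //; apply: measurableI.
    by rewrite -[X in measurable X]setTI; exact: measurable_lee.
  by rewrite -[X in measurable X]setTI; exact: measurable_lte.
apply: filterS2 le1 le2 => t; rewrite /= !lee_fin => h1 h2.
by apply/eqP; rewrite eq_le h1 h2.
Qed.

(** The positive and negative parts of the real and imaginary parts of v f vanish
    off S(v), hence are fixed by the conditional expectation. *)
Lemma cond_mul_op_mul f : dom EMv f ->
  {ae mu, forall t, condexp mu A (v \* f) t = v t * f t}.
Proof.
move=> [L2f cvf _]; have [[mr mi] _] := cvf.
have [v1 v2 v3 v4] := re_im_parts_version subA sfA cvf.
pose a t := complex.Re ((v \* f) t); pose b t := complex.Im ((v \* f) t).
have z0 : {ae mu, forall t, w t = 0 -> a t = 0 /\ b t = 0}.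
  by apply: filterS vw => t e h; rewrite /a /b /= e h mul0r.
have e1 := version_supported (measurable_funrpos mr) (funrpos_ge0 a) _ v1.
have e2 := version_supported (measurable_funrneg mr) (funrneg_ge0 a) _ v2.
have e3 := version_supported (measurable_funrpos mi) (funrpos_ge0 b) _ v3.
have e4 := version_supported (measurable_funrneg mi) (funrneg_ge0 b) _ v4.
have s1 : {ae mu, forall t, w t = 0 -> a^\+ t = 0}.
  by apply: filterS z0 => t h /h[h1 _]; rewrite /funrpos h1 maxxx.
have s2 : {ae mu, forall t, w t = 0 -> a^\- t = 0}.
  by apply: filterS z0 => t h /h[h1 _]; rewrite /funrneg h1 oppr0 maxxx.
have s3 : {ae mu, forall t, w t = 0 -> b^\+ t = 0}.
  by apply: filterS z0 => t h /h[_ h1]; rewrite /funrpos h1 maxxx.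
have s4 : {ae mu, forall t, w t = 0 -> b^\- t = 0}.
  by apply: filterS z0 => t h /h[_ h1]; rewrite /funrneg h1 oppr0 maxxx.
have ra : {ae mu, forall t, rcondexp mu A a t = a t}.
  apply: filterS3 (rcondexp_eq subA sfA mr v1 v2) (e1 s1) (e2 s2) => t -> -> ->.
  by rewrite -[RHS](congr1 (@^~ t) (funrposBneg a)).
have rb : {ae mu, forall t, rcondexp mu A b t = b t}.
  apply: filterS3 (rcondexp_eq subA sfA mi v3 v4) (e3 s3) (e4 s4) => t -> -> ->.
  by rewrite -[RHS](congr1 (@^~ t) (funrposBneg b)).
by apply: filterS2 ra rb => t h1 h2; apply: complex_ext; rewrite /condexp /= ?h1 ?h2.
Qed.

End Multiplication.

(** * Hyperexpansivity *)

Section Hyperexpansivity.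
Context (d : measure_display) (T : measurableType d) (R : realType).
Variable mu : {measure set T -> \bar R}.
Variable A : set (set T).
Hypothesis subA : sub_sigma_algebra_of A.
Hypothesis sfA : sigma_finite_on mu A.
Variable v : T -> R[i].
Hypothesis cv : conditionable mu A v.
Let mv : cmeasurable v := proj1 cv.
Local Notation EMv := (cond_mul_op mu A v).
Local Notation w := (condexp mu A v).
Hypothesis vw : {ae mu, forall t, v t = w t}.
Hypothesis Emul : forall f, dom EMv f ->
  {ae mu, forall t, condexp mu A (v \* f) t = v t * f t}.

Lemma dom_pow_L2 n f : dom_pow mu EMv n f -> L2 mu f.
Proof. by case: n => [//|n] /= [[]]. Qed.

Lemma iter_cond_mul_op n i f : dom_pow mu EMv n f -> (i <= n)%N ->
  L2 mu (iter i (oper EMv) f) /\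
  {ae mu, forall t, iter i (oper EMv) f t = v t ^+ i * f t}.
Proof.
elim: n i f => [|n IH] [|i] f df // ilen.
- by split; [exact: df|apply: aeW => t; rewrite mul1r].
- by split; [exact: dom_pow_L2 df|apply: aeW => t; rewrite mul1r].
have [df1 df2] := df; rewrite iterSr; have [L2i Ei] := IH i _ df2 ilen.
split => //; apply: filterS2 Ei (Emul df1) => t -> E.
by rewrite [oper _ _ _]E exprSr mulrA.
Qed.

Let sqv t := modc (v t) ^+ 2.

Lemma l2norm_iter n i f : dom_pow mu EMv n f -> (i <= n)%N ->
  mu.-integrable [set: T] (fun t => (sqv t ^+ i * modc (f t) ^+ 2)%:E) /\
  l2norm mu (iter i (oper EMv) f) ^+ 2 =
  fine (\int[mu]_t (sqv t ^+ i * modc (f t) ^+ 2)%:E)%E.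
Proof.
move=> df ilen; have [[mi foo] Ei] := iter_cond_mul_op df ilen.
have [mf _] := dom_pow_L2 df.
have mI : measurable_fun [set: T] (fun t => (sqv t ^+ i * modc (f t) ^+ 2)%:E).
  apply/measurable_EFinP/measurable_funM.
    exact/measurable_funX/measurable_funX/measurable_modc.
  exact/measurable_funX/measurable_modc.
have E : (\int[mu]_t ((modc (iter i (oper EMv) f t)) ^+ 2)%:E =
    \int[mu]_t (sqv t ^+ i * modc (f t) ^+ 2)%:E)%E.
  apply: ae_eq_integral => //; first exact: measurable_sqr_modc.
  apply: filterS Ei => t -> _; rewrite modcM modcX exprMn /sqv.
  by rewrite -!exprM mulnC.
split; last by rewrite l2norm_sqr E.
apply/integrableP; split => //.
rewrite (_ : (\int[mu]_t `|(sqv t ^+ i * modc (f t) ^+ 2)%:E|)%E =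
  (\int[mu]_t (sqv t ^+ i * modc (f t) ^+ 2)%:E)%E); first by rewrite -E.
apply: eq_integral => t _; rewrite gee0_abs// lee_fin mulr_ge0 ?sqr_ge0//.
by rewrite exprn_ge0 ?sqr_ge0.
Qed.

Lemma Theta_integral n f : dom_pow mu EMv n f ->
  mu.-integrable [set: T]
    (EFin \o (fun t => Aseq n (sqv t) * modc (f t) ^+ 2)) /\
  Theta mu EMv n f = (\int[mu]_t (Aseq n (sqv t) * modc (f t) ^+ 2))%R.
Proof.
move=> df.
pose c (i : 'I_n.+1) : R := (-1) ^+ i * 'C(n, i)%:R.
pose h (i : 'I_n.+1) t := (sqv t ^+ i * modc (f t) ^+ 2)%:E.
have ih i : mu.-integrable [set: T] (h i).
  by have [] := l2norm_iter df (leq_ord i).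
have ich i : mu.-integrable [set: T] (fun t => (c i)%:E * h i t)%E by exact: integrableZl.
have E : EFin \o (fun t => Aseq n (sqv t) * modc (f t) ^+ 2) =
    (fun t => \sum_(i < n.+1) ((c i)%:E * h i t))%E.
  apply/funext => t; rewrite /= /Aseq mulr_suml -sumEFin; apply: eq_bigr => i _.
  by rewrite /h -EFinM; congr EFin; rewrite /c !mulrA.
split; first by rewrite E; exact: integrable_sum.
rewrite /Rintegral (_ : (\int[mu]_t (Aseq n (sqv t) * modc (f t) ^+ 2)%:E)%E =
  (\sum_(i < n.+1) \int[mu]_t ((c i)%:E * h i t))%E); last first.
  by rewrite -integral_sum// -E.
rewrite /Theta; transitivity (fine (\sum_(i < n.+1)
    (c i * fine (\int[mu]_t h i t)%E)%:E)%E).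
  rewrite sumEFin /=; apply: eq_bigr => i _.
  by have [_ ->] := l2norm_iter df (leq_ord i).
congr fine; apply: eq_bigr => i _; rewrite integralZl// EFinM fineK//.
exact: integrable_fin_num.
Qed.

Lemma measurable_Aseq n : measurable_fun [set: T] (fun t => Aseq n (sqv t)).
Proof.
apply: measurable_sum => i; apply: measurable_funM => //.
exact/measurable_funX/measurable_funX/measurable_modc.
Qed.

(** For the direct implication the test functions are the indicators of
    {A_n(|v|^2) > 0} intersected with slices, which lie in the domain of every
    power of the operator. *)
Lemma Theta_le0_iff n :
  (forall f, dom_pow mu EMv n f -> Theta mu EMv n f <= 0) <->
  {ae mu, forall t, Aseq n (sqv t) <= 0}.
Proof.
split=> [H|An f df]; last first.
  have [ih ->] := Theta_integral df; rewrite /Rintegral.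
  have [mf _] := dom_pow_L2 df.
  pose h t := Aseq n (sqv t) * modc (f t) ^+ 2.
  have mh : measurable_fun [set: T] h.
    by apply: measurable_funM; [exact: measurable_Aseq|exact/measurable_funX/measurable_modc].
  have -> : (\int[mu]_t (h t)%:E = \int[mu]_t (- (- Num.min (h t) 0)%:E))%E.
    apply: ae_eq_integral => //.
    - exact/measurable_EFinP.
    - apply: measurableT_comp => //; apply/measurable_EFinP; apply: measurable_funN.
      exact: measurable_minr.
    - apply: filterS An => t h0 _; rewrite -EFinN opprK; congr EFin.
      by apply/esym/min_idPl; rewrite /h mulr_le0_ge0// sqr_ge0.
  rewrite integral_ge0N; last first.
    by move=> t _; rewrite lee_fin oppr_ge0 ge_min lexx orbT.
  rewrite fineN oppr_le0 fine_ge0// integral_ge0// => t _.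
  by rewrite lee_fin oppr_ge0 ge_min lexx orbT.
have [D [AD Dfin DT Dw]] := slices_exist subA sfA cv.
pose X m := D m `&` [set t | 0 < Aseq n (sqv t)].
have mX m : measurable (X m).
  apply: measurableI; first exact: measurableA_sub (AD m).
  exact: measurable_set_ltr (measurable_Aseq n).
have X0 m : {ae mu, forall t, ~ X m t}.
  have df : dom_pow mu EMv n (fun t => (\1_(X m) t)%:C).
    apply: (bounded_on_dom_pow subA sfA cv vw (AD m) (Dfin m) (Dw m)).
    by apply: bounded_on_indic => // t [].
  have [ih ThE] := Theta_integral df.
  pose h t := Aseq n (sqv t) * modc (\1_(X m) t)%:C ^+ 2.
  have h0 t : 0 <= h t.
    rewrite /h modc_real indicE; case: (boolP (t \in X m)) => [|_].
      by rewrite inE => -[_ /= /ltW A0]; rewrite mulr_ge0// sqr_ge0.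
    by rewrite normr0 expr0n mulr0.
  have I0 : (0 <= \int[mu]_t (h t)%:E)%E.
    by apply: integral_ge0 => t _; rewrite lee_fin.
  have Ifin : (\int[mu]_t (h t)%:E)%E \is a fin_num by exact: integrable_fin_num ih.
  have : fine (\int[mu]_t (h t)%:E)%E <= 0 by rewrite -[X in X <= _]ThE; exact: H.
  move=> fle; have E : (\int[mu]_t `|(h t)%:E| = 0)%E.
    rewrite (eq_integral (EFin \o h)); last first.
      by move=> t _; rewrite gee0_abs// lee_fin.
    apply/eqP; rewrite eq_le I0 andbT; move: fle; rewrite -lee_fin fineK//.
  have mh : measurable_fun [set: T] (EFin \o h) by move/integrableP : ih => [].
  have /(ae_eq_integral_abs mu measurableT mh) := E.
  apply: filterS => t /(_ I) [] + Xt; rewrite /h modc_real indicE mem_set// normr1 expr1n mulr1.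
  by case: Xt => _ /= A0 e; rewrite e ltxx in A0.
have : {ae mu, forall t, forall m, ~ X m t} by apply: ae_foralln.
apply: filterS => t nX; rewrite leNgt; apply/negP => A0.
by have : [set: T] t by []; rewrite -DT => -[m _ Dmt]; apply: (nX m).
Qed.

End Hyperexpansivity.

Lemma alternating_Aseq (R : realType) (r : R) (m n : nat) :
  \sum_(i < n.+1) (-1) ^+ i * 'C(n, i)%:R * r ^+ (2 * (m + i)) =
  (r ^+ 2) ^+ m * Aseq n (r ^+ 2).
Proof.
rewrite /Aseq mulr_sumr; apply: eq_bigr => i _.
by rewrite exprM exprD; ring.
Qed.

Theorem mainTheorem10 (d : measure_display) (Omega : measurableType d)
    (R : realType) (mu : {measure set Omega -> \bar R})
    (A : set (set Omega)) (v : Omega -> R[i]) (k : nat)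
    (mu_sfinite : sigma_finite [set: Omega] mu)
    (subA : sub_sigma_algebra_of A)
    (muA_sfinite : sigma_finite_on mu A)
    (v_conditionable : conditionable mu A v)
    (EMv_normal : normal_operator mu (cond_mul_op mu A v))
    (EMv_dense : densely_defined mu (cond_mul_op mu A v))
    (k_ge1 : (1 <= k)%N)
    (E_sq : forall f, dom_pow mu (cond_mul_op mu A v) k f ->
       {ae mu, forall t, v t != 0 ->
          ((modc (condexp mu A f t)) ^+ 2)%:E =
          nncondexp mu A (fun s => ((modc (f s)) ^+ 2)%:E) t}) :
  (hyperexpansive mu (cond_mul_op mu A v) k <->
     (forall n, (1 <= n <= k)%N ->
        {ae mu, forall t, Aseq n (modc (v t) ^+ 2) <= 0}))
  /\
  (completely_hyperexpansive mu (cond_mul_op mu A v) <->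
     {ae mu, forall t,
        completely_alternating (fun n => modc (v t) ^+ (2 * n))}).
Proof.
have vw := normal_multiplier_measurable subA muA_sfinite v_conditionable EMv_normal.
have Emul := cond_mul_op_mul subA muA_sfinite v_conditionable vw E_sq.
have key := Theta_le0_iff subA muA_sfinite v_conditionable vw Emul.
split; first by split=> H n nk; [apply/key/H|apply/key/H].
split=> [H|H n n1]; last first.
  apply/key; apply: filterS H => t /(_ 0%N n n1).
  by rewrite alternating_Aseq expr0 mul1r.
have : {ae mu, forall t, forall n, (1 <= n)%N -> Aseq n (modc (v t) ^+ 2) <= 0}.
  apply: ae_foralln => n; case: (ltnP 0 n) => [n1|_]; last exact: aeW.
  by apply: filterS (iffLR (key n) (H n n1)) => t.
apply: filterS => t At m n n1; rewrite alternating_Aseq.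
by rewrite mulr_ge0_le0 ?At// exprn_ge0// sqr_ge0.
Qed.
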